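(* Let $n\ge 2$, $\mathfrak g=\mathfrak{sl}_{n+1}(\mathbb C)$, let $\Gamma$ be the standard Gelfand--Tsetlin subalgebra, let $f=E_{21}$, and let $M$ be a $\Gamma$-relation module on which $f$ acts injectively. Then for every $x\in\mathbb C$ the twisted localization $D_f^{x}M$ of $M$ is a $\Gamma$-relation Gelfand--Tsetlin module.
   Context: **Setting.** $\mathfrak g=\mathfrak{sl}_{n+1}(\mathbb C)$, $E_{ij}$ are matrix units, $H_k=E_{kk}-E_{k+1,k+1}$. The standard Gelfand--Tsetlin subalgebra $\Gamma$ is the image in $U(\mathfrak{sl}_{n+1})$ (under the natural projection $\mathfrak{gl}_{n+1}\to\mathfrak{sl}_{n+1}$) of the subalgebra of $U(\mathfrak{gl}_{n+1})$ generated by the centers of $U(\mathfrak{gl}_m)$, $m=1,\dots,n+1$, where $\mathfrak{gl}_m$ is spanned by $E_{ij}$, $1\le i,j\le m$. **Relation modules.** Let $\mathfrak V=\{(i,j): 1\le j\le i\le n+1\}$, and $\mathcal R=\mathcal R^-\cup\mathcal R^0\cup\mathcal R^+\subset\mathfrak V\times\mathfrak V$ with $\mathcal R^+=\{((i,j);(i-1,t)): 2\le i\le n+1,\ 1\le j\le i,\ 1\le t\le i-1\}$, $\mathcal R^-=\{((i,j);(i+1,s)): 1\le j\le i\le n,\ 1\le s\le i+1\}$, $\mathcal R^0=\{((n+1,i);(n+1,j)): 1\le i\ne j\le n+1\}$. A set of relations is a subset $\mathcal C\subseteq\mathcal R$; $G(\mathcal C)$ is the directed graph with vertex set $\mathfrak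 V$ and an arrow from $a$ to $b$ for each $(a;b)\in\mathcal C$. A Gelfand--Tsetlin tableau $T(L)$ is given by $L=(l_{ij})_{(i,j)\in\mathfrak V}$, $l_{ij}\in\mathbb C$. $T(L)$ *satisfies* $\mathcal C$ if $l_{ij}-l_{rs}\in\mathbb Z_{\ge0}$ for all $((i,j);(r,s))\in\mathcal C\cap(\mathcal R^+\cup\mathcal R^0)$ and $l_{ij}-l_{rs}\in\mathbb Z_{>0}$ for all $((i,j);(r,s))\in\mathcal C\cap\mathcal R^-$. $T(L)$ is a *$\mathcal C$-realization* if it satisfies $\mathcal C$ and, for all $1\le k\le n$, $l_{ki}-l_{kj}\in\mathbb Z$ if and only if $(k,i)$ and $(k,j)$ lie in the same connected component of the undirected graph underlying $G(\mathcal C)$. $\mathcal B_{\mathcal C}(T(L))$ is the set of all tableaux $T(L+z)$ satisfying $\mathcal C$, where $z=(z_{ij})$ has integer entries and $z_{n+1,j}=0$ for all $j$; $V_{\mathcal C}(T(L))$ is the complex vector space with basis $\mathcal B_{\mathcal C}(T(L))$. $\mathcal C$ is *admissible* if for every $\mathcal C$-realization $T(L)$ the space $V_{\mathcal C}(T(L))$ is a $\mathfrak g$-module under $$E_{k,k+1}T(w)=-\sum_{i=1}^{k}\frac{\prod_{j=1}^{k+1}(w_{ki}-w_{k+1,j})}{\prod_{j\ne i}^{k}(w_{ki}-w_{kj})}T(w+\delta^{ki}),\qquad E_{k+1,k}T(w)=\sum_{i=1}^{k}\frac{\prod_{j=1}^{k-1}(w_{ki}-w_{k-1,j})}{\prod_{j\ne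 i}^{k}(w_{ki}-w_{kj})}T(w-\delta^{ki}),$$ $$H_kT(w)=\Big(2\sum_{i=1}^{k}w_{ki}-\sum_{i=1}^{k-1}w_{k-1,i}-\sum_{i=1}^{k+1}w_{k+1,i}-1\Big)T(w),$$ where $\delta^{ki}$ is the unit vector at position $(k,i)$, empty products are $1$, and terms with $T(w\pm\delta^{ki})\notin\mathcal B_{\mathcal C}(T(L))$ are read as $0$. A *$\Gamma$-relation (Gelfand--Tsetlin) module* is a $\mathfrak g$-module isomorphic to $V_{\mathcal C}(T(L))$ for some admissible $\mathcal C$ and some $\mathcal C$-realization $T(L)$. **Twisted localization.** Let $D_fU(\mathfrak g)$ be the localization of $U(\mathfrak g)$ with respect to $\{f^i: i\ge0\}$ and $D_fM=D_fU(\mathfrak g)\otimes_{U(\mathfrak g)}M$. For $x\in\mathbb C$ let $\Theta_f^x$ be the automorphism $\Theta_f^x(u)=\sum_{i\ge0}\binom{x}{i}\,\mathrm{ad}(f)^i(u)\,f^{-i}$ of $D_fU(\mathfrak g)$. Then $D_f^xM$ is the vector space $D_fM$ with the action twisted by $\Theta_f^x$ ($u$ acts as $\Theta_f^x(u)$), regarded as a $\mathfrak g$-module. *)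

(* Defs.v *)
From HB Require Import structures.
From mathcomp Require Import all_boot all_order all_algebra.
From mathcomp Require Import finmap.
From mathcomp Require Import boolp classical_sets functions cardinality fsbigop.
From mathcomp Require Import reals.
From mathcomp Require Import complex.
From mathcomp Require Import monalg.

Set Implicit Arguments.
Unset Strict Implicit.
Unset Printing Implicit Defensive.

Import GRing.Theory.
Local Open Scope ring_scope.
Local Open Scope quotient_scope.

Section SpecialLinear.
Variables (K : fieldType) (n : nat).

Definition traceless : {pred 'M[K]_n.+1} := fun A => \tr A == 0.

Lemma tracelessE A : (A \in traceless) = (\tr A == 0).
Proof. by []. Qed.

Lemma traceless_submod : submod_closed traceless.
Proof.
split=> [|a A B /eqP hA /eqP hB]; first by rewrite tracelessE mxtrace0.
by rewrite tracelessE mxtraceD mxtraceZ hA hB mulr0 addr0.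
Qed.
HB.instance Definition _ :=
  GRing.isSubmodClosed.Build K 'M[K]_n.+1 traceless traceless_submod.

Record sl := Sl { sl_mx :> 'M[K]_n.+1; sl_tr : sl_mx \in traceless }.
HB.instance Definition _ := [isSub for sl_mx].
HB.instance Definition _ := [Choice of sl by <:].
HB.instance Definition _ := [SubChoice_isSubLmodule of sl by <:].

Lemma bracket_subproof (A B : sl) : A *m B - B *m A \in traceless.
Proof. by rewrite tracelessE raddfB /= mxtrace_mulC subrr. Qed.
Definition bracket (A B : sl) : sl := Sl (bracket_subproof A B).

Lemma offdiag_subproof (i j : 'I_n.+1) : i != j -> delta_mx i j \in traceless.
Proof.
move=> ij; rewrite tracelessE /mxtrace big1 // => k _; rewrite mxE.
by case: eqP => //= ->; rewrite (negPf ij).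
Qed.

Lemma neq_widen_lift (k : 'I_n) : widen_ord (leqnSn n) k != lift ord0 k.
Proof. by rewrite -val_eqE /= /bump /= neq_ltn ltnSn. Qed.

(* The index k : 'I_n starts at 0: raise k, lower k and cart k are
   E_{k+1,k+2}, E_{k+2,k+1} and H_{k+1} in 1-based notation. *)
Definition raise (k : 'I_n) : sl := Sl (offdiag_subproof (neq_widen_lift k)).

Lemma lower_subproof (k : 'I_n) : lift ord0 k != widen_ord (leqnSn n) k.
Proof. by rewrite eq_sym neq_widen_lift. Qed.
Definition lower (k : 'I_n) : sl := Sl (offdiag_subproof (lower_subproof k)).

Lemma diag_subproof (i j : 'I_n.+1) :
  (delta_mx i i - delta_mx j j : 'M[K]_n.+1) \in traceless.
Proof.
have tr1 k : \tr (delta_mx k k : 'M[K]_n.+1) = 1.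
  rewrite /mxtrace (bigD1 k) //= big1 ?mxE ?eqxx ?addr0 // => l /negPf lk.
  by rewrite mxE lk.
by rewrite tracelessE raddfB /= !tr1 subrr.
Qed.
Definition cart (k : 'I_n) : sl :=
  Sl (diag_subproof (widen_ord (leqnSn n) k) (lift ord0 k)).

Definition is_gmodule (V : lmodType K) (rho : sl -> V -> V) : Prop :=
  [/\ forall A (c : K) v w, rho A (c *: v + w) = c *: rho A v + rho A w,
      forall (c : K) A B v, rho (c *: A + B) v = c *: rho A v + rho B v
    & forall A B v, rho (bracket A B) v = rho A (rho B v) - rho B (rho A v)].

Definition gmodule_iso (V W : lmodType K)
    (rho : sl -> V -> V) (sigma : sl -> W -> W) : Prop :=
  exists2 phi : {linear V -> W},
    bijective phi & forall A v, phi (rho A v) = sigma A (phi v).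

End SpecialLinear.

Section Presentation.
Variables (K : fieldType) (X : Type).

Inductive term : Type :=
| Var of X
| Const of K
| Add of term & term
| Mul of term & term.

Variable r : term -> term -> Prop.

(* The least congruence containing r whose quotient is a K-algebra. *)
Inductive cong : term -> term -> Prop :=
| cong_rel s t : r s t -> cong s t
| cong_refl s : cong s s
| cong_sym s t : cong s t -> cong t s
| cong_trans s t u : cong s t -> cong t u -> cong s u
| cong_add s s' t t' : cong s s' -> cong t t' -> cong (Add s t) (Add s' t')
| cong_mul s s' t t' : cong s s' -> cong t t' -> cong (Mul s t) (Mul s' t')
| cong_addA s t u : cong (Add s (Add t u)) (Add (Add s t) u)
| cong_addC s t : cong (Add s t) (Add t s)
| cong_add0 s : cong (Add (Const 0) s) s
| cong_mulA s t u : cong (Mul s (Mul t u)) (Mul (Mul s t) u)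
| cong_mul1 s : cong (Mul (Const 1) s) s
| cong_mul0 s : cong (Mul (Const 0) s) (Const 0)
| cong_mulDl s t u : cong (Mul (Add s t) u) (Add (Mul s u) (Mul t u))
| cong_mulDr s t u : cong (Mul s (Add t u)) (Add (Mul s t) (Mul s u))
| cong_constD a b : cong (Const (a + b)) (Add (Const a) (Const b))
| cong_constM a b : cong (Const (a * b)) (Mul (Const a) (Const b))
| cong_constC a s : cong (Mul (Const a) s) (Mul s (Const a)).

HB.instance Definition _ := gen_eqMixin term.
HB.instance Definition _ := gen_choiceMixin term.

Definition congb : rel term := fun s t => `[< cong s t >].

Lemma congb_refl : reflexive congb.
Proof. by move=> s; apply/asboolP; exact: cong_refl. Qed.
Lemma congb_sym : symmetric congb.
Proof. by move=> s t; apply/asboolP/asboolP; exact: cong_sym. Qed.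
Lemma congb_trans : transitive congb.
Proof.
by move=> t s u /asboolP st /asboolP tu; apply/asboolP; exact: cong_trans tu.
Qed.
Canonical cong_equiv := EquivRel congb congb_refl congb_sym congb_trans.

Definition palg := {eq_quot cong_equiv}.
HB.instance Definition _ := Choice.on palg.
HB.instance Definition _ := EqQuotient.on palg.

Definition pclass (t : term) : palg := \pi t.

Lemma pclassP s t : pclass s = pclass t <-> cong s t.
Proof.
by split=> [/eqmodP/asboolP //|st]; apply/eqmodP/asboolP.
Qed.

Lemma cong_repr t : cong (repr (pclass t)) t.
Proof. by apply/pclassP; rewrite /pclass reprK. Qed.

Lemma pclassK (u : palg) : pclass (repr u) = u.
Proof. exact: reprK. Qed.

Lemma palgW (P : palg -> Prop) : (forall t, P (pclass t)) -> forall u, P u.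
Proof. by move=> h u; rewrite -(pclassK u). Qed.

Definition padd (u v : palg) : palg := pclass (Add (repr u) (repr v)).
Definition pmul (u v : palg) : palg := pclass (Mul (repr u) (repr v)).
Definition pscale (c : K) (u : palg) : palg := pclass (Mul (Const c) (repr u)).

Lemma paddE s t : padd (pclass s) (pclass t) = pclass (Add s t).
Proof. by apply/pclassP/cong_add; exact: cong_repr. Qed.
Lemma pmulE s t : pmul (pclass s) (pclass t) = pclass (Mul s t).
Proof. by apply/pclassP/cong_mul; exact: cong_repr. Qed.
Lemma pscaleE c t : pscale c (pclass t) = pclass (Mul (Const c) t).
Proof. by apply/pclassP/cong_mul; [exact: cong_refl|exact: cong_repr]. Qed.

Lemma paddA : associative padd.
Proof.
move=> u v w; elim/palgW: u => s; elim/palgW: v => t; elim/palgW: w => u.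
by rewrite !paddE; apply/pclassP/cong_addA.
Qed.
Lemma paddC : commutative padd.
Proof.
move=> u v; elim/palgW: u => s; elim/palgW: v => t.
by rewrite !paddE; apply/pclassP/cong_addC.
Qed.
Lemma padd0 : left_id (pclass (Const 0)) padd.
Proof. by elim/palgW=> s; rewrite paddE; apply/pclassP/cong_add0. Qed.
Lemma paddN : left_inverse (pclass (Const 0)) (pscale (- 1)) padd.
Proof.
elim/palgW=> s; rewrite pscaleE paddE; apply/pclassP.
apply: cong_trans (cong_mul0 s).
apply: cong_trans (cong_add (cong_refl _) (cong_sym (cong_mul1 s))) _.
apply: cong_trans (cong_sym (cong_mulDl _ _ _)) _.
apply: cong_mul (cong_refl _).
by have := cong_sym (cong_constD (- 1) 1); rewrite addNr.
Qed.
HB.instance Definition _ := GRing.isZmodule.Build palg paddA paddC padd0 paddN.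

Lemma pmulA : associative pmul.
Proof.
move=> u v w; elim/palgW: u => s; elim/palgW: v => t; elim/palgW: w => u.
by rewrite !pmulE; apply/pclassP/cong_mulA.
Qed.
Lemma pmul1l : left_id (pclass (Const 1)) pmul.
Proof. by elim/palgW=> s; rewrite pmulE; apply/pclassP/cong_mul1. Qed.
Lemma pmul1r : right_id (pclass (Const 1)) pmul.
Proof.
elim/palgW=> s; rewrite pmulE; apply/pclassP.
exact: cong_trans (cong_sym (cong_constC _ _)) (cong_mul1 _).
Qed.
Lemma pmulDl : left_distributive pmul padd.
Proof.
move=> u v w; elim/palgW: u => s; elim/palgW: v => t; elim/palgW: w => u.
by rewrite paddE !pmulE paddE; apply/pclassP/cong_mulDl.
Qed.
Lemma pmulDr : right_distributive pmul padd.
Proof.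
move=> u v w; elim/palgW: u => s; elim/palgW: v => t; elim/palgW: w => u.
by rewrite paddE !pmulE paddE; apply/pclassP/cong_mulDr.
Qed.
HB.instance Definition _ :=
  GRing.Zmodule_isPzRing.Build palg pmulA pmul1l pmul1r pmulDl pmulDr.

Lemma pscaleA a b u : pscale a (pscale b u) = pscale (a * b) u.
Proof.
elim/palgW: u => s; rewrite !pscaleE; apply/pclassP.
apply: cong_trans (cong_mulA _ _ _) _.
exact/cong_mul/cong_refl/cong_sym/cong_constM.
Qed.
Lemma pscale1 : left_id 1 pscale.
Proof. by elim/palgW=> s; rewrite pscaleE; apply/pclassP/cong_mul1. Qed.
Lemma pscaleDr : right_distributive pscale +%R.
Proof.
move=> c u v; elim/palgW: u => s; elim/palgW: v => t.
by rewrite [_ + _]paddE !pscaleE [RHS]paddE; apply/pclassP/cong_mulDr.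
Qed.
Lemma pscaleDl u : {morph pscale^~ u : a b / a + b}.
Proof.
move=> a b; elim/palgW: u => s; rewrite !pscaleE [RHS]paddE; apply/pclassP.
apply: cong_trans (cong_mulDl _ _ _).
exact: cong_mul (cong_constD _ _) (cong_refl _).
Qed.
HB.instance Definition _ :=
  GRing.Zmodule_isLmodule.Build K palg pscaleA pscale1 pscaleDr pscaleDl.

Lemma palg_scalerAl (c : K) (u v : palg) : c *: (u * v) = (c *: u) * v.
Proof.
elim/palgW: u => s; elim/palgW: v => t.
rewrite [_ * _]pmulE [LHS]pscaleE [_ *: _]pscaleE [RHS]pmulE.
exact/pclassP/cong_mulA.
Qed.

End Presentation.

Section Localization.
Variables (K : fieldType) (X : Type) (r : term K X -> term K X -> Prop).
Notation A := (palg r).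
Variable S : set A.

(* The algebra obtained from A by universally inverting S: inl a stands for the
   image of a, inr s for the inverse of s.  It is the Ore localization of A
   whenever S satisfies the Ore conditions, as the powers of an ad-nilpotent
   element do. *)
Definition loc_gen : Type := A + {s : A | S s}.

Inductive loc_rel : term K loc_gen -> term K loc_gen -> Prop :=
| loc_lin (c : K) (u v : A) :
    loc_rel (Var _ (inl (c *: u + v)))
            (Add (Mul (Const _ c) (Var _ (inl u))) (Var _ (inl v)))
| loc_one : loc_rel (Var _ (inl 1)) (Const _ 1)
| loc_mul (u v : A) :
    loc_rel (Var _ (inl (u * v))) (Mul (Var _ (inl u)) (Var _ (inl v)))
| loc_mulV (s : {s : A | S s}) :
    loc_rel (Mul (Var _ (inl (sval s))) (Var _ (inr s))) (Const _ 1)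
| loc_Vmul (s : {s : A | S s}) :
    loc_rel (Mul (Var _ (inr s)) (Var _ (inl (sval s)))) (Const _ 1).

Definition localization := palg loc_rel.
HB.instance Definition _ := GRing.PzRing.on localization.
HB.instance Definition _ := GRing.Lmodule.on localization.

Definition loc_map (a : A) : localization := pclass loc_rel (Var _ (inl a)).
Definition loc_inv (s : A) (hs : S s) : localization :=
  pclass loc_rel (Var _ (inr (exist _ s hs))).

End Localization.

(* D is a right A-module through j : A -> D, and M is a left A-module through
   act; the tensor product of D and M over A is a left D-module. *)
Section Tensor.
Variables (K : fieldType) (X : Type) (r : term K X -> term K X -> Prop).
Notation D := (palg r).
Variables (A : Type) (j : A -> D) (M : zmodType) (act : A -> M -> M).

Inductive tterm : Type :=
| TZero
| TPure of D & M
| TOpp of tterm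
| TAdd of tterm & tterm.

Inductive tcong : tterm -> tterm -> Prop :=
| tcong_refl s : tcong s s
| tcong_sym s t : tcong s t -> tcong t s
| tcong_trans s t u : tcong s t -> tcong t u -> tcong s u
| tcong_add s s' t t' :
    tcong s s' -> tcong t t' -> tcong (TAdd s t) (TAdd s' t')
| tcong_opp s s' : tcong s s' -> tcong (TOpp s) (TOpp s')
| tcong_addA s t u : tcong (TAdd s (TAdd t u)) (TAdd (TAdd s t) u)
| tcong_addC s t : tcong (TAdd s t) (TAdd t s)
| tcong_add0 s : tcong (TAdd TZero s) s
| tcong_addN s : tcong (TAdd (TOpp s) s) TZero
| tcong_pureDl d d' m :
    tcong (TPure (d + d') m) (TAdd (TPure d m) (TPure d' m))
| tcong_pureDr d m m' :
    tcong (TPure d (m + m')) (TAdd (TPure d m) (TPure d m'))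
| tcong_balanced d a m : tcong (TPure (d * j a) m) (TPure d (act a m)).

HB.instance Definition _ := gen_eqMixin tterm.
HB.instance Definition _ := gen_choiceMixin tterm.

Definition tcongb : rel tterm := fun s t => `[< tcong s t >].

Lemma tcongb_refl : reflexive tcongb.
Proof. by move=> s; apply/asboolP; exact: tcong_refl. Qed.
Lemma tcongb_sym : symmetric tcongb.
Proof. by move=> s t; apply/asboolP/asboolP; exact: tcong_sym. Qed.
Lemma tcongb_trans : transitive tcongb.
Proof.
by move=> t s u /asboolP st /asboolP tu; apply/asboolP; exact: tcong_trans tu.
Qed.
Canonical tcong_equiv := EquivRel tcongb tcongb_refl tcongb_sym tcongb_trans.

Definition tensor := {eq_quot tcong_equiv}.
HB.instance Definition _ := Choice.on tensor.
HB.instance Definition _ := EqQuotient.on tensor.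

Definition tclass (t : tterm) : tensor := \pi t.

Lemma tclassP s t : tclass s = tclass t <-> tcong s t.
Proof. by split=> [/eqmodP/asboolP //|st]; apply/eqmodP/asboolP. Qed.

Lemma tcong_repr t : tcong (repr (tclass t)) t.
Proof. by apply/tclassP; rewrite /tclass reprK. Qed.

Lemma tensorW (P : tensor -> Prop) : (forall t, P (tclass t)) -> forall u, P u.
Proof. by move=> h u; rewrite -(reprK u). Qed.

Definition tadd (u v : tensor) : tensor := tclass (TAdd (repr u) (repr v)).
Definition topp (u : tensor) : tensor := tclass (TOpp (repr u)).

Lemma taddE s t : tadd (tclass s) (tclass t) = tclass (TAdd s t).
Proof. by apply/tclassP/tcong_add; exact: tcong_repr. Qed.
Lemma toppE s : topp (tclass s) = tclass (TOpp s).
Proof. by apply/tclassP/tcong_opp; exact: tcong_repr. Qed.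

Lemma taddA : associative tadd.
Proof.
move=> u v w; elim/tensorW: u => s; elim/tensorW: v => t; elim/tensorW: w => u.
by rewrite !taddE; apply/tclassP/tcong_addA.
Qed.
Lemma taddC : commutative tadd.
Proof.
move=> u v; elim/tensorW: u => s; elim/tensorW: v => t.
by rewrite !taddE; apply/tclassP/tcong_addC.
Qed.
Lemma tadd0 : left_id (tclass TZero) tadd.
Proof. by elim/tensorW=> s; rewrite taddE; apply/tclassP/tcong_add0. Qed.
Lemma taddN : left_inverse (tclass TZero) topp tadd.
Proof. by elim/tensorW=> s; rewrite toppE taddE; apply/tclassP/tcong_addN. Qed.
HB.instance Definition _ := GRing.isZmodule.Build tensor taddA taddC tadd0 taddN.

Definition pure (d : D) (m : M) : tensor := tclass (TPure d m).

Fixpoint tmul (d : D) (t : tterm) : tterm :=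
  match t with
  | TZero => TZero
  | TPure d' m => TPure (d * d') m
  | TOpp t => TOpp (tmul d t)
  | TAdd s t => TAdd (tmul d s) (tmul d t)
  end.

Lemma tmul_cong d s t : tcong s t -> tcong (tmul d s) (tmul d t).
Proof.
elim=> {s t} /=.
- by move=> s; exact: tcong_refl.
- by move=> s t _; exact: tcong_sym.
- by move=> s t u _ + _; exact: tcong_trans.
- by move=> s s' t t' _ + _; exact: tcong_add.
- by move=> s s' _; exact: tcong_opp.
- by move=> s t u; exact: tcong_addA.
- by move=> s t; exact: tcong_addC.
- by move=> s; exact: tcong_add0.
- by move=> s; exact: tcong_addN.
- by move=> d1 d2 m; rewrite mulrDr; exact: tcong_pureDl.
- by move=> d1 m m'; exact: tcong_pureDr.
- by move=> d1 a m; rewrite mulrA; exact: tcong_balanced.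
Qed.

Definition tensor_act (d : D) (u : tensor) : tensor := tclass (tmul d (repr u)).

Lemma tensor_actE d t : tensor_act d (tclass t) = tclass (tmul d t).
Proof. exact/tclassP/tmul_cong/tcong_repr. Qed.

Lemma tensor_act_pure d d' m : tensor_act d (pure d' m) = pure (d * d') m.
Proof. exact: tensor_actE. Qed.

Lemma tensor_actD d u v :
  tensor_act d (u + v) = tensor_act d u + tensor_act d v.
Proof.
elim/tensorW: u => s; elim/tensorW: v => t.
by rewrite [_ + _]taddE !tensor_actE [RHS]taddE.
Qed.
Lemma tensor_actN d u : tensor_act d (- u) = - tensor_act d u.
Proof.
by elim/tensorW: u => s; rewrite [- _]toppE !tensor_actE [RHS]toppE.
Qed.
Lemma pureDl d d' m : pure (d + d') m = pure d m + pure d' m.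
Proof. by rewrite [RHS]taddE; apply/tclassP/tcong_pureDl. Qed.

Lemma tensor_ind (P : tensor -> Prop) :
  P 0 -> (forall d m, P (pure d m)) -> (forall u, P u -> P (- u)) ->
  (forall u v, P u -> P v -> P (u + v)) -> forall u, P u.
Proof.
move=> P0 Pp PN PD; elim/tensorW; elim=> // [s|s Ps t Pt].
  by rewrite -toppE; exact: PN.
by rewrite -taddE; exact: PD.
Qed.

Lemma tensor_act0 d : tensor_act d 0 = 0.
Proof. exact: tensor_actE. Qed.

Lemma tensor_actM d d' u :
  tensor_act d (tensor_act d' u) = tensor_act (d * d') u.
Proof.
elim/tensor_ind: u => [|d1 m|u IH|u v IHu IHv].
- by rewrite !tensor_act0.
- by rewrite !tensor_act_pure mulrA.
- by rewrite !tensor_actN IH.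
- by rewrite !tensor_actD IHu IHv.
Qed.
Lemma tensor_act1 u : tensor_act 1 u = u.
Proof.
elim/tensor_ind: u => [|d1 m|u IH|u v IHu IHv].
- by rewrite !tensor_act0.
- by rewrite !tensor_act_pure mul1r.
- by rewrite !tensor_actN IH.
- by rewrite !tensor_actD IHu IHv.
Qed.
Lemma tensor_actDl d d' u :
  tensor_act (d + d') u = tensor_act d u + tensor_act d' u.
Proof.
elim/tensor_ind: u => [|d1 m|u IH|u v IHu IHv].
- by rewrite !tensor_act0 addr0.
- by rewrite !tensor_act_pure mulrDl pureDl.
- by rewrite !tensor_actN IH opprD.
- by rewrite !tensor_actD IHu IHv addrACA.
Qed.

Definition tensor_scale (c : K) (u : tensor) : tensor := tensor_act (c *: (1 : D)) u.

Lemma tensor_scaleA a b u :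
  tensor_scale a (tensor_scale b u) = tensor_scale (a * b) u.
Proof.
by rewrite /tensor_scale tensor_actM -palg_scalerAl mul1r scalerA.
Qed.
Lemma tensor_scale1 : left_id 1 tensor_scale.
Proof. by move=> u; rewrite /tensor_scale scale1r tensor_act1. Qed.
Lemma tensor_scaleDr : right_distributive tensor_scale +%R.
Proof. by move=> c u v; exact: tensor_actD. Qed.
Lemma tensor_scaleDl u : {morph tensor_scale^~ u : a b / a + b}.
Proof. by move=> a b; rewrite /tensor_scale scalerDl tensor_actDl. Qed.
HB.instance Definition _ := GRing.Zmodule_isLmodule.Build K tensor
  tensor_scaleA tensor_scale1 tensor_scaleDr tensor_scaleDl.

End Tensor.

Section Enveloping.
Variables (K : fieldType) (n : nat).
Notation g := (sl K n).

Inductive U_rel : term K g -> term K g -> Prop :=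
| U_lin (c : K) (A B : g) :
    U_rel (Var _ (c *: A + B)) (Add (Mul (Const _ c) (Var _ A)) (Var _ B))
| U_bracket (A B : g) :
    U_rel (Var _ (bracket A B))
          (Add (Mul (Var _ A) (Var _ B))
               (Mul (Const _ (- 1)) (Mul (Var _ B) (Var _ A)))).

Definition Ug := palg U_rel.
HB.instance Definition _ := GRing.PzRing.on Ug.
HB.instance Definition _ := GRing.Lmodule.on Ug.

Definition U_of (A : g) : Ug := pclass U_rel (Var _ A).

Variables (M : lmodType K) (rho : g -> M -> M).

(* The extension of a g-action to U(g), first on terms; by term_act_cong it does
   not depend on the representative when M is a g-module. *)
Fixpoint term_act (t : term K g) (m : M) : M :=
  match t with
  | Var A => rho A m
  | Const c => c *: m
  | Add s t => term_act s m + term_act t m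
  | Mul s t => term_act s (term_act t m)
  end.

Definition U_act (u : Ug) (m : M) : M := term_act (repr u) m.

Lemma term_act_cong s t : is_gmodule rho -> cong U_rel s t ->
  term_act s =1 term_act t.
Proof.
move=> [lin linA brk].
have tlin u c v w : term_act u (c *: v + w) = c *: term_act u v + term_act u w.
  elim: u v w => /= [A|a|u IHu u' IHu'|u IHu u' IHu'] v w.
  - exact: lin.
  - by rewrite scalerDr !scalerA mulrC.
  - by rewrite IHu IHu' scalerDr addrACA.
  - by rewrite IHu' IHu.
have tD u v w : term_act u (v + w) = term_act u v + term_act u w.
  by have := tlin u 1 v w; rewrite !scale1r.
have t0 u : term_act u 0 = 0.
  by apply: (addIr (term_act u 0)); rewrite -tD !add0r.
have tZ u c v : term_act u (c *: v) = c *: term_act u v.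
  by have := tlin u c v 0; rewrite t0 !addr0.
elim=> {s t} /=.
- move=> _ _ [c A B|A B] m /=; first exact: linA.
  by rewrite brk scaleN1r.
- by [].
- by move=> s t _ IH m.
- by move=> s t u _ IH _ IH' m; rewrite IH.
- by move=> s s' t t' _ IH _ IH' m; rewrite IH IH'.
- by move=> s s' t t' _ IH _ IH' m; rewrite IH IH'.
- by move=> s t u m; rewrite addrA.
- by move=> s t m; rewrite addrC.
- by move=> s m; rewrite scale0r add0r.
- by [].
- by move=> s m; rewrite scale1r.
- by move=> s m; rewrite !scale0r.
- by [].
- by move=> s t u m; rewrite tD.
- by move=> a b m; rewrite scalerDl.
- by move=> a b m; rewrite scalerA.
- by move=> a s m; rewrite tZ.
Qed.

Lemma U_actE t m : is_gmodule rho -> U_act (pclass U_rel t) m = term_act t m.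
Proof. by move=> h; apply: term_act_cong => //; exact: cong_repr. Qed.

Variable f : g.

Definition f_powers : set Ug := [set u | exists i : nat, u = U_of f ^+ i].

Definition DfU := localization f_powers.
HB.instance Definition _ := GRing.PzRing.on DfU.
HB.instance Definition _ := GRing.Lmodule.on DfU.

Definition DfU_of : Ug -> DfU := @loc_map _ _ _ f_powers.
Definition f_inv (i : nat) : DfU :=
  @loc_inv _ _ _ f_powers (U_of f ^+ i) (ex_intro _ i erefl).

Definition ad (a u : DfU) : DfU := a * u - u * a.

Definition gbinom (x : K) (i : nat) : K :=
  (\prod_(k < i) (x - k%:R)) / (i`!)%:R.

(* For nilpotent f, such as a matrix unit off the diagonal, ad f is locally
   nilpotent on DfU, so that the sum has finite support. *)
Definition Theta (x : K) (u : DfU) : DfU :=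
  \sum_(i \in [set: nat])
    gbinom x i *: (iter i (ad (DfU_of (U_of f))) u * f_inv i).

Definition DfM := tensor DfU_of U_act.
HB.instance Definition _ := GRing.Lmodule.on DfM.

Definition twisted_act (x : K) (A : g) (v : DfM) : DfM :=
  tensor_act (Theta x (DfU_of (U_of A))) v.

End Enveloping.

Arguments twisted_act {K n M} rho f x A v.

Section Relations.
Variable n : nat.

(* Rows and columns are numbered from 1. *)
Definition vertex := {p : 'I_n.+2 * 'I_n.+2 | (1 <= p.2 <= p.1)%N}.
Definition row_of (a : vertex) : nat := (val a).1.

Definition Rplus : rel vertex := fun a b => row_of a == (row_of b).+1.
Definition Rminus : rel vertex := fun a b => row_of b == (row_of a).+1.
Definition Rzero : rel vertex := fun a b =>
  [&& row_of a == n.+1, row_of b == n.+1 & a != b].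

Definition relations : {set vertex * vertex} :=
  [set p | [|| Rplus p.1 p.2, Rminus p.1 p.2 | Rzero p.1 p.2]].

Definition linked (C : {set vertex * vertex}) : rel vertex :=
  connect (fun a b => ((a, b) \in C) || ((b, a) \in C)).

Variable K : fieldType.

Definition tableau := {ffun vertex -> K}.

Definition satisfies (C : {set vertex * vertex}) (L : tableau) : Prop :=
  forall a b, (a, b) \in C ->
    (Rplus a b || Rzero a b -> exists m : nat, L a - L b = m%:R) /\
    (Rminus a b -> exists m : nat, L a - L b = m.+1%:R).

Definition realization (C : {set vertex * vertex}) (L : tableau) : Prop :=
  satisfies C L /\
  forall a b, row_of a = row_of b -> (row_of a <= n)%N ->
    (exists z : int, L a - L b = z%:~R) <-> linked C a b.

Definition in_basis (C : {set vertex * vertex}) (L w : tableau) : Prop :=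
  exists z : {ffun vertex -> int},
    [/\ forall a, row_of a = n.+1 -> z a = 0,
        forall a, w a = L a + (z a)%:~R
      & satisfies C w].

Definition basis (C : {set vertex * vertex}) (L : tableau) : Type :=
  {w : tableau | `[< in_basis C L w >]}.
HB.instance Definition _ C L := Choice.on (basis C L).

Definition VC (C : {set vertex * vertex}) (L : tableau) : Type :=
  {malg K[basis C L]}.
HB.instance Definition _ C L := GRing.Lmodule.on (VC C L).

(* The basis vector T(w), read as 0 when T(w) is not in the basis. *)
Definition ket (C : {set vertex * vertex}) (L w : tableau) : VC C L :=
  if insub w is Some u then mkmalgU (u : basis C L) 1 else 0.

Definition shift (w : tableau) (a : vertex) (e : K) : tableau :=
  [ffun b => w b + (if b == a then e else 0)].

Definition raise_coef (k : nat) (w : tableau) (a : vertex) : K :=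
  (\prod_(b : vertex | row_of b == k.+1) (w a - w b)) /
  (\prod_(b : vertex | (row_of b == k) && (b != a)) (w a - w b)).

Definition lower_coef (k : nat) (w : tableau) (a : vertex) : K :=
  (\prod_(b : vertex | row_of b == k.-1) (w a - w b)) /
  (\prod_(b : vertex | (row_of b == k) && (b != a)) (w a - w b)).

Definition cart_coef (k : nat) (w : tableau) : K :=
  2%:R * (\sum_(b : vertex | row_of b == k) w b)
  - (\sum_(b : vertex | row_of b == k.-1) w b)
  - (\sum_(b : vertex | row_of b == k.+1) w b) - 1.

(* The Gelfand--Tsetlin formulas for E_{k,k+1}, E_{k+1,k} and H_k, with the
   1-based index k of the formulas written k.+1 for k : 'I_n. *)
Definition gt_action (C : {set vertex * vertex}) (L : tableau)
    (rho : sl K n -> VC C L -> VC C L) : Prop :=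
  forall (k : 'I_n) (w : tableau), in_basis C L w ->
  [/\ rho (raise K k) (ket C L w) =
        - \sum_(a : vertex | row_of a == k.+1)
            raise_coef k.+1 w a *: ket C L (shift w a 1),
      rho (lower K k) (ket C L w) =
        \sum_(a : vertex | row_of a == k.+1)
            lower_coef k.+1 w a *: ket C L (shift w a (- 1))
    & rho (cart K k) (ket C L w) = cart_coef k.+1 w *: ket C L w].

(* The denominators of the Gelfand--Tsetlin formulas do not vanish on the
   basis; in a field 1 / 0 = 0, so this has to be required explicitly. *)
Definition regular (C : {set vertex * vertex}) (L : tableau) : Prop :=
  forall w, in_basis C L w -> forall a b, a != b -> row_of a = row_of b ->
    (row_of a <= n)%N -> w a <> w b.

Definition admissible (C : {set vertex * vertex}) : Prop :=
  C \subset relations /\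
  forall L, realization C L ->
    regular C L /\
    exists rho : sl K n -> VC C L -> VC C L, is_gmodule rho /\ gt_action rho.

Definition relation_module (V : lmodType K) (sigma : sl K n -> V -> V) : Prop :=
  is_gmodule sigma /\
  exists (C : {set vertex * vertex}) (L : tableau)
         (rho : sl K n -> VC C L -> VC C L),
    [/\ admissible C, realization C L, is_gmodule rho, gt_action rho
      & gmodule_iso rho sigma].

End Relations.

(* Main.v *)
From HB Require Import structures.
From mathcomp Require Import all_boot all_order all_algebra.
From mathcomp Require Import finmap.
From mathcomp Require Import boolp classical_sets functions cardinality fsbigop.
From mathcomp Require Import reals complex monalg.
From mathcomp Require Import ring zify.
Require Import Defs.

Set Implicit Arguments.
Unset Strict Implicit.
Unset Printing Implicit Defensive.

Import GRing.Theory.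
Local Open Scope ring_scope.

(** Let V = V_C(T(L)) be a relation module and f = E_21. On V the element f
    lowers the entry (1, 1) of a tableau, with coefficient 1. If f is injective,
    then no relation of C bounds this entry from below
    ([lower_inj_no_out11]), and the relations of C that involve (1, 1) only
    bound it from above. Let C' = [drop11 C] be the set of the other relations.
    Then the twisted localization D_f ^ x V is V_C'(T(L')), where L' is L with
    its entry (1, 1) increased by x.

    The space W = V_C'(T(L')) contains V: a tableau of V is sent to the same
    tableau with its entry (1, 1) increased by x. The operator f extends to an
    invertible operator F of W, and every vector of W is moved into V by a power
    of F. As ad f has cube zero, the operators f ^ y A f ^ (- y) are given by
    three terms of a binomial series, and f ^ (y + 2) A f ^ (- y) makes sense on
    V for every scalar y ([conj_op]). Reading these operators off on F ^ k v for
    large k gives an action of sl on W for each twisting parameter ([twist],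
    [twist_gmodule]). With parameter 0, W is a module containing V on which f
    acts by F, so the localized algebra acts on W and there is a map from the
    tensor product D_f V to W. It is bijective, because every vector of D_f V is
    a fraction f ^ (- k) m ([has_numeratorT]), and it carries the action twisted
    by Theta to [twist] ([DfM_map_twisted], [twist_binom]).

    For the Gelfand-Tsetlin formulas, the coefficients are polynomials of degree
    at most 2 in the entry (1, 1). On vectors deep enough for the relations that
    involve (1, 1) to play no role, the three terms of the conjugated operator
    are Newton's interpolation formula, which evaluates these polynomials at the
    entry shifted by x ([twist_newton], [twisted_gt]).

    It remains to see that C' is admissible and that L' is a realization of C'.
    The point is that removing (1, 1) does not disconnect two entries of row 2
    related to it: if it did, a translation of one component would give a
    realization of C with two equal entries in row 2, against regularity
    ([in11_linked]). Hence every realization of C' comes from one of C by a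
    change of the entry (1, 1), and the module required by admissibility is a
    twisted localization of a module for C ([admissible_drop11]). *)

(** * Modules over the special linear algebra *)

Section GmoduleTheory.
Variables (K : fieldType) (n : nat) (V : lmodType K) (rho : sl K n -> V -> V).
Hypothesis rhoP : is_gmodule rho.

Lemma gmodP A c v w : rho A (c *: v + w) = c *: rho A v + rho A w.
Proof. by case: rhoP. Qed.

Lemma gmodD A v w : rho A (v + w) = rho A v + rho A w.
Proof. by have := gmodP A 1 v w; rewrite !scale1r. Qed.

Lemma gmod0 A : rho A 0 = 0.
Proof. by apply: (addIr (rho A 0)); rewrite -gmodD !add0r. Qed.

Lemma gmodZ A c v : rho A (c *: v) = c *: rho A v.
Proof. by have := gmodP A c v 0; rewrite gmod0 !addr0. Qed.

Lemma gmodN A v : rho A (- v) = - rho A v.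
Proof. by rewrite -scaleN1r gmodZ scaleN1r. Qed.

Lemma gmodDl A B v : rho (A + B) v = rho A v + rho B v.
Proof. by case: rhoP => _ h _; have := h 1 A B v; rewrite !scale1r. Qed.

Lemma gmod0l v : rho 0 v = 0.
Proof. by apply: (addIr (rho 0 v)); rewrite -gmodDl !add0r. Qed.

Lemma gmodZl c A v : rho (c *: A) v = c *: rho A v.
Proof. by case: rhoP => _ h _; have := h c A 0 v; rewrite gmod0l !addr0. Qed.

Lemma gmod_bracket A B v :
  rho (bracket A B) v = rho A (rho B v) - rho B (rho A v).
Proof. by case: rhoP. Qed.

End GmoduleTheory.

Section Bracket.
Variables (K : fieldType) (n : nat).
Implicit Types A B f : sl K n.

Lemma sl_inj A B : sl_mx A = sl_mx B -> A = B.
Proof. exact: val_inj. Qed.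

Lemma bracketP f c A B :
  bracket f (c *: A + B) = c *: bracket f A + bracket f B.
Proof.
apply: sl_inj => /=.
rewrite mulmxDr mulmxDl -scalemxAl -scalemxAr scalerBr opprD.
by rewrite addrACA.
Qed.

Lemma bracketxx f : bracket f f = 0.
Proof. by apply: sl_inj; rewrite /= subrr. Qed.

Lemma bracketf0 f : bracket f 0 = 0.
Proof. by apply: sl_inj; rewrite /= mulmx0 mul0mx subrr. Qed.

Lemma ad3_sq0 f A : sl_mx f *m sl_mx f = 0 ->
  bracket f (bracket f (bracket f A)) = 0.
Proof.
move=> ff; apply: sl_inj => /=.
have ff0 (X : 'M_n.+1) : sl_mx f *m (sl_mx f *m X) = 0.
  by rewrite mulmxA ff mul0mx.
rewrite !(mulmxBl, mulmxBr) -!mulmxA ff.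
by rewrite !(ff0, mulmx0, oppr0, subr0, addr0, sub0r, opprK, mul0mx).
Qed.

Lemma lower_sq0 (k : 'I_n) : sl_mx (lower K k) *m sl_mx (lower K k) = 0.
Proof.
by rewrite /= mul_delta_mx_0 // eq_sym -val_eqE /= /bump /= neq_ltn ltnSn orbT.
Qed.

End Bracket.

(** * Conjugation by powers of f *)

Section Gbinom.
Variable K : fieldType.

Lemma gbinom0 (x : K) : gbinom x 0 = 1.
Proof. by rewrite /gbinom big_ord0 fact0 divr1. Qed.
Lemma gbinom1 (x : K) : gbinom x 1 = x.
Proof. by rewrite /gbinom big_ord_recl big_ord0 /= subr0 mulr1 divr1. Qed.
Lemma gbinom2 (x : K) : gbinom x 2 = x * (x - 1) / 2%:R.
Proof. by rewrite /gbinom !big_ord_recl big_ord0 /= subr0 mulr1. Qed.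

(** The polynomial functions of degree at most 2. *)
Definition quadratic (g : K -> K) : Prop :=
  exists c0 c1 c2, forall t, g t = c0 + c1 * t + c2 * t ^+ 2.

(** Newton's interpolation formula at the nodes -2, -1 and 0. *)
Lemma newton2 (g : K -> K) (y : K) : 2%:R != 0 :> K -> quadratic g ->
  g (- 2%:R) + (y + 2%:R) * (g (- 1) - g (- 2%:R))
  + gbinom (y + 2%:R) 2 * (g 0 - g (- 1) - (g (- 1) - g (- 2%:R))) = g y.
Proof. by move=> two0 [c0 [c1 [c2 gE]]]; rewrite gbinom2 !gE; field. Qed.

End Gbinom.

(** Reduces a linear identity between vectors of the form rho A v, in a space
    with a basis, to an identity between their coordinates. *)
Ltac malg_coords rho :=
  repeat match goal with
  | |- context [rho ?A ?v] => generalize (rho A v); intro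
  end;
  apply/malgP => t; rewrite !(mcoeffD, mcoeffB, mcoeffZ, mcoeffN, mcoeff0).

Section ConjOp.
Variables (K : fieldType) (n : nat) (T : choiceType).
Hypothesis char0 : [pchar K] =i pred0.
Notation M := {malg K[T]}.
Variables (rho : sl K n -> M -> M) (f : sl K n).
Hypothesis rhoP : is_gmodule rho.
Hypothesis adf3 : forall A, bracket f (bracket f (bracket f A)) = 0.

Let two0 : 2%:R != 0 :> K.
Proof. by have /pcharf0P -> := char0. Qed.

(** The operator f ^ (y + 2) A f ^ (- y) on a module where f need not be
    invertible. *)
Definition conj_op (y : K) (A : sl K n) (m : M) : M :=
  rho A (rho f (rho f m)) + (y + 2%:R) *: rho (bracket f A) (rho f m)
  + gbinom (y + 2%:R) 2 *: rho (bracket f (bracket f A)) m.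

Lemma conj_opP y A c v w :
  conj_op y A (c *: v + w) = c *: conj_op y A v + conj_op y A w.
Proof.
rewrite /conj_op !(gmodP rhoP).
by malg_coords rho; ring.
Qed.

Lemma conj_opPl y c A B m :
  conj_op y (c *: A + B) m = c *: conj_op y A m + conj_op y B m.
Proof.
rewrite /conj_op !bracketP !(gmodDl rhoP) !(gmodZl rhoP).
by malg_coords rho; ring.
Qed.

(* Moving f to the right past A, [f, A] and [f, [f, A]]. *)
Let fA A m : rho f (rho A m) = rho A (rho f m) + rho (bracket f A) m.
Proof. by rewrite (gmod_bracket rhoP) addrC subrK. Qed.

(* Not a rewriting rule for A = f, where it would loop. *)
Let fA012 A := (fA A, fA (bracket f A), fA (bracket f (bracket f A)),
  adf3, gmod0l rhoP, gmod0 rhoP).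

Let rhoE : (forall A u v, rho A (u + v) = rho A u + rho A v)
  * (forall A u, rho A (- u) = - rho A u)
  * (forall A c u, rho A (c *: u) = c *: rho A u).
Proof. by do !split; [exact: gmodD|exact: gmodN|exact: gmodZ]. Qed.

Lemma conj_op_shift y A m :
  rho f (conj_op y A m) = conj_op (y + 1) A (rho f m).
Proof.
rewrite /conj_op !rhoE !gbinom2 !(fA012 A, rhoE).
by malg_coords rho; field.
Qed.

(** The Leibniz expansion of f ^ (y + 4) A B f ^ (- y), with f on the right. *)
Lemma conj_op_comp y A B m :
  conj_op (y + 2%:R) A (conj_op y B m) =
  rho A (rho B (rho f (rho f (rho f (rho f m)))))
  + (y + 4%:R) *: (rho A (rho (bracket f B) (rho f (rho f (rho f m))))
                   + rho (bracket f A) (rho B (rho f (rho f (rho f m)))))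
  + ((y + 4%:R) * (y + 3%:R) / 2%:R) *:
      (rho A (rho (bracket f (bracket f B)) (rho f (rho f m)))
       + 2%:R *: rho (bracket f A) (rho (bracket f B) (rho f (rho f m)))
       + rho (bracket f (bracket f A)) (rho B (rho f (rho f m))))
  + ((y + 4%:R) * (y + 3%:R) * (y + 2%:R) / 2%:R) *:
      (rho (bracket f A) (rho (bracket f (bracket f B)) (rho f m))
       + rho (bracket f (bracket f A)) (rho (bracket f B) (rho f m)))
  + ((y + 4%:R) * (y + 3%:R) * (y + 2%:R) * (y + 1) / 4%:R) *:
      rho (bracket f (bracket f A)) (rho (bracket f (bracket f B)) m).
Proof.
have four0 : 4%:R != 0 :> K by have /pcharf0P -> := char0.
rewrite {1}/conj_op !conj_op_shift /conj_op !gbinom2 !rhoE.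
malg_coords rho; field.
by rewrite two0 four0.
Qed.

Lemma adf1_bracket A B v : rho (bracket f (bracket A B)) v
   = rho A (rho (bracket f B) v) + rho (bracket f A) (rho B v)
   - (rho B (rho (bracket f A) v) + rho (bracket f B) (rho A v)).
Proof.
rewrite (gmod_bracket rhoP f (bracket A B)) !(gmod_bracket rhoP A B) !rhoE.
rewrite !(fA012 A, fA012 B, rhoE).
by malg_coords rho; ring.
Qed.

Lemma adf2_bracket A B v : rho (bracket f (bracket f (bracket A B))) v
   = rho A (rho (bracket f (bracket f B)) v)
     + 2%:R *: rho (bracket f A) (rho (bracket f B) v)
     + rho (bracket f (bracket f A)) (rho B v)
   - (rho B (rho (bracket f (bracket f A)) v)
     + 2%:R *: rho (bracket f B) (rho (bracket f A) v)
     + rho (bracket f (bracket f B)) (rho A v)).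
Proof.
rewrite (gmod_bracket rhoP f (bracket f (bracket A B))).
rewrite !(adf1_bracket A B) !rhoE.
rewrite !(fA012 A, fA012 B, rhoE).
by malg_coords rho; ring.
Qed.

(** Since ad f has cube zero, (ad f) ^ 3 [A, B] = 0; by the Leibniz rule this
    is 3 ([A1, B2] + [A2, B1]) = 0, for Ai = (ad f) ^ i A, Bi = (ad f) ^ i B. *)
Lemma adf3_bracket A B v :
  rho (bracket f A) (rho (bracket f (bracket f B)) v)
  + rho (bracket f (bracket f A)) (rho (bracket f B) v)
  = rho (bracket f B) (rho (bracket f (bracket f A)) v)
  + rho (bracket f (bracket f B)) (rho (bracket f A) v).
Proof.
have three0 : 3%:R != 0 :> K by have /pcharf0P -> := char0.
have := congr1 (rho^~ v) (adf3 (bracket A B)).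
rewrite (gmod0l rhoP).
rewrite (gmod_bracket rhoP f (bracket f (bracket f (bracket A B)))).
rewrite !(adf2_bracket A B) !rhoE !(fA012 A, fA012 B, rhoE) => e.
apply: (scalerI three0); apply/eqP; rewrite -subr_eq0; apply/eqP.
rewrite -[RHS]e.
by malg_coords rho; ring.
Qed.

(** The commutator of f with the preceding identity. *)
Lemma adf4_bracket A B v :
  rho (bracket f (bracket f A)) (rho (bracket f (bracket f B)) v)
  = rho (bracket f (bracket f B)) (rho (bracket f (bracket f A)) v).
Proof.
apply: (scalerI two0).
have := congr1 (rho f) (adf3_bracket A B v).
rewrite !rhoE !(fA012 A, fA012 B, rhoE) => e.
apply/eqP; rewrite -subr_eq0; apply/eqP.
move/eqP: e; rewrite -subr_eq0 => /eqP e.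
have /eqP := adf3_bracket A B (rho f v); rewrite -subr_eq0 => /eqP e3.
rewrite -[RHS]e -[LHS]addr0 -[X in _ + X]e3.
by malg_coords rho; ring.
Qed.

(** Conjugation by powers of f respects brackets: the Leibniz terms of
    orders three and four of the two products cancel. *)
Lemma conj_op_bracket y A B m :
  conj_op (y + 2%:R) A (conj_op y B m) - conj_op (y + 2%:R) B (conj_op y A m)
  = rho f (rho f (conj_op y (bracket A B) m)).
Proof.
have four0 : 4%:R != 0 :> K by have /pcharf0P -> := char0.
rewrite !conj_op_comp adf3_bracket adf4_bracket !conj_op_shift.
rewrite /conj_op !gbinom2.
rewrite (gmod_bracket rhoP A B) (adf1_bracket A B) (adf2_bracket A B).
malg_coords rho; field.
by rewrite two0 four0.
Qed.

(** The binomial series for conjugation by f ^ x, multiplied by f ^ (y + 4) on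
    the left and f ^ (- y) on the right. *)
Lemma conj_op_binom x y A m :
  rho f (rho f (conj_op (x + y) A m)) =
  rho f (rho f (conj_op y A m))
  + x *: rho f (conj_op (y + 1) (bracket f A) m)
  + gbinom x 2 *: conj_op (y + 2%:R) (bracket f (bracket f A)) m.
Proof.
rewrite !conj_op_shift /conj_op !gbinom2 !adf3 bracketf0 !(gmod0l rhoP).
by malg_coords rho; field.
Qed.

Lemma conj_op_f y m : conj_op y f m = rho f (rho f (rho f m)).
Proof.
by rewrite /conj_op bracketxx bracketf0 !(gmod0l rhoP) !scaler0 !addr0.
Qed.

Lemma conj_op0 A m : conj_op 0 A m = rho f (rho f (rho A m)).
Proof.
rewrite (fA A) rhoE (fA A) (fA (bracket f A)) /conj_op add0r gbinom2.
by malg_coords rho; field.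
Qed.

End ConjOp.

(** * The twisted action on a space where f is invertible *)

Section Twist.
Variables (K : fieldType) (n : nat) (T : choiceType).
Hypothesis char0 : [pchar K] =i pred0.
Notation M := {malg K[T]}.
Variables (rho : sl K n -> M -> M) (f : sl K n).
Hypothesis rhoP : is_gmodule rho.
Hypothesis adf3 : forall A, bracket f (bracket f (bracket f A)) = 0.
Variables (W : lmodType K) (iota : {linear M -> W}).
Hypothesis iota_inj : injective iota.
Variables (F : {linear W -> W}) (Fi : W -> W).
Hypotheses (FK : cancel F Fi) (FiK : cancel Fi F).
Hypothesis F_iota : forall m, F (iota m) = iota (rho f m).
Hypothesis loc : forall v, exists k m, iter k F v = iota m.
Notation conj_op := (conj_op rho f).

Lemma iter_F_inj k : injective (iter k F).
Proof. by elim: k => [|k IH] u v //= /(can_inj FK)/IH. Qed.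

Lemma iter_FK k v : iter k F (iter k Fi v) = v.
Proof. by elim: k v => [|k IH] v //; rewrite iterSr iterS FiK IH. Qed.

Lemma iter_FP k c u v : iter k F (c *: u + v) = c *: iter k F u + iter k F v.
Proof. by elim: k => [|k IH] //=; rewrite IH linearP. Qed.

Lemma iter_FD k u v : iter k F (u + v) = iter k F u + iter k F v.
Proof. by have := iter_FP k 1 u v; rewrite !scale1r. Qed.

Lemma iter_FZ k c v : iter k F (c *: v) = c *: iter k F v.
Proof. by elim: k => [|k IH] //=; rewrite IH linearZ. Qed.

Lemma iter_F_sum k (I : finType) (P : pred I) (e : I -> W) :
  iter k F (\sum_(i | P i) e i) = \sum_(i | P i) iter k F (e i).
Proof. by elim: k => //= k ->; rewrite linear_sum. Qed.

Lemma iter_FB k u v : iter k F (u - v) = iter k F u - iter k F v.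
Proof. by rewrite addrC -scaleN1r iter_FP scaleN1r addrC. Qed.

Lemma iter_F_iota k m : iter k F (iota m) = iota (iter k (rho f) m).
Proof. by elim: k => [|k IH] //=; rewrite IH F_iota. Qed.

Lemma conj_op_iter k y A m :
  iter k (rho f) (conj_op y A m) = conj_op (y + k%:R) A (iter k (rho f) m).
Proof.
elim: k => [|k IH] /=; first by rewrite addr0.
by rewrite IH (conj_op_shift char0) // -natr1 addrA.
Qed.

(** The vector f ^ x A f ^ (- x) v does not depend on the power of f used to
    move v into M. *)
Lemma twist_exists x A v : exists u, forall k m, iter k F v = iota m ->
  iter k.+2 F u = iota (conj_op (x + k%:R) A m).
Proof.
have [k0 [m0 e0]] := loc v.
exists (iter k0.+2 Fi (iota (conj_op (x + k0%:R) A m0))) => k m e.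
apply: (iter_F_inj (k := k0)).
have iterC u : iter k0 F (iter k.+2 F u) = iter k F (iter k0.+2 F u).
  by rewrite -!iterD !addnS addnC.
rewrite iterC iter_FK !iter_F_iota !conj_op_iter addrAC.
congr (iota (conj_op _ _ _)).
by apply: iota_inj; rewrite -!iter_F_iota -e -e0 -!iterD addnC.
Qed.

(** The action of A on the twisted localization: the operator
    f ^ x A f ^ (- x), read off on the deep enough translates of a vector
    by f. *)
Definition twist (x : K) (A : sl K n) (v : W) : W :=
  sval (cid (twist_exists x A v)).

Lemma twistP x A v k m : iter k F v = iota m ->
  iter k.+2 F (twist x A v) = iota (conj_op (x + k%:R) A m).
Proof. by move=> e; rewrite (svalP (cid (twist_exists x A v)) _ _ e). Qed.

Lemma twist_unique x A v u k m : iter k F v = iota m ->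
  iter k.+2 F u = iota (conj_op (x + k%:R) A m) -> u = twist x A v.
Proof.
by move=> e eu; apply: (iter_F_inj (k := k.+2)); rewrite eu (twistP _ _ e).
Qed.

Lemma loc2 u v : exists k m m', iter k F u = iota m /\ iter k F v = iota m'.
Proof.
have [k [m e]] := loc u; have [l [m' e']] := loc v.
exists (k + l)%N, (iter l (rho f) m), (iter k (rho f) m').
by rewrite -!iter_F_iota -e -e' -!iterD addnC.
Qed.

Lemma twist_gmodule x : is_gmodule (twist x).
Proof.
split=> [A c v w|c A B v|A B v].
- have [k [m [m' [em em']]]] := loc2 v w.
  have e : iter k F (c *: v + w) = iota (c *: m + m').
    by rewrite iter_FP em em' linearP.
  apply: (iter_F_inj (k := k.+2)).
  rewrite iter_FP (twistP _ _ e) (twistP _ _ em) (twistP _ _ em').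
  by rewrite conj_opP // linearP.
- have [k [m e]] := loc v; apply: (iter_F_inj (k := k.+2)).
  by rewrite iter_FP !(twistP _ _ e) conj_opPl // linearP.
- have [k [m e]] := loc v; apply: (iter_F_inj (k := k.+4)).
  rewrite iter_FB (twistP x A (twistP x B e)) (twistP x B (twistP x A e)).
  have -> : x + k.+2%:R = x + k%:R + 2%:R by rewrite -addn2 natrD addrA.
  rewrite -(linearB iota) (conj_op_bracket char0) //.
  by rewrite (iterS k.+3) (iterS k.+2) (twistP _ _ e) !F_iota.
Qed.

Lemma twist_f x v : twist x f v = F v.
Proof.
have [k [m e]] := loc v; apply/esym/(twist_unique e).
by rewrite conj_op_f // -iterSr !iterS e !F_iota.
Qed.

Lemma twist_iota A m : twist 0 A (iota m) = iota (rho A m).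
Proof.
apply/esym/(@twist_unique 0 A (iota m) (iota (rho A m)) 0 m erefl).
by rewrite addr0 conj_op0 //= !F_iota.
Qed.

(** The twisted action is the series defining Theta, applied to the untwisted
    action. *)
Lemma twist_binom x A v : twist x A v =
  twist 0 A v + x *: twist 0 (bracket f A) (Fi v)
  + gbinom x 2 *: twist 0 (bracket f (bracket f A)) (Fi (Fi v)).
Proof.
have [k [m e]] := loc v.
have e1 : iter k.+1 F (Fi v) = iota m by rewrite iterSr FiK.
have e2 : iter k.+2 F (Fi (Fi v)) = iota m by rewrite !iterSr !FiK.
apply: (iter_F_inj (k := k.+4)).
rewrite !iter_FD !iter_FZ (twistP _ _ e2) (iterS k.+3 F (twist 0 _ (Fi v))).
rewrite (twistP _ _ e1) !(iterS k.+3) !(iterS k.+2) !(twistP _ _ e) !F_iota.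
rewrite (conj_op_binom char0) // !add0r -[k.+2]addn2 -[k.+1]addn1 !natrD.
by do 3!move: (conj_op _ _ _) => ?; rewrite !linearD !linearZ.
Qed.

(** Suppose that A sends f ^ j m to a sum of vectors F ^ j e_i whose
    coefficients are quadratic functions g_i of - j. Then the twisted action of
    A sends v = F ^ (- k) m to the sum of the vectors F ^ (- k) e_i, with the
    values of these functions at x + k as coefficients. *)
Lemma twist_newton x A v k m (I : finType) (P : pred I) (e : I -> W)
    (g : I -> K -> K) :
  iter k F v = iota m -> (forall i, P i -> quadratic (g i)) ->
  (forall j, (j <= 2)%N -> iota (rho A (iter j (rho f) m)) =
     \sum_(i | P i) g i (- j%:R) *: iter j F (e i)) ->
  iter k F (twist x A v) = \sum_(i | P i) g i (x + k%:R) *: e i.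
Proof.
move=> ev gq H; apply: (iter_F_inj (k := 2)); rewrite -iterD (twistP _ _ ev).
have two0 : 2%:R != 0 :> K by have /pcharf0P -> := char0.
set y := x + k%:R.
have br B u :
    iota (rho (bracket f B) u) = F (iota (rho B u)) - iota (rho B (rho f u)).
  by rewrite (gmod_bracket rhoP) linearB F_iota.
rewrite /conj_op 2!(linearD iota) !linearZZ !br.
have /= -> := H 0 isT; have /= -> := H 1 isT; have /= -> := H 2 isT.
rewrite (linearB F) !(linear_sum F) !(scaler_sumr, =^~ sumrB, =^~ big_split) /=.
apply: eq_bigr => i Pi; rewrite oppr0 !(linearZZ F).
by rewrite -!scalerBl !scalerA -!scalerDl newton2 //; exact: gq.
Qed.

End Twist.

(** * Actions of presented algebras *)

Section PresentedAction.
Variables (K : fieldType) (X : Type) (r : term K X -> term K X -> Prop).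
Variables (W : lmodType K) (g : X -> W -> W).

(** The operator on W denoted by a term whose variables act through g. *)
Fixpoint term_eval (t : term K X) (w : W) : W :=
  match t with
  | Var x => g x w
  | Const c => c *: w
  | Add s t => term_eval s w + term_eval t w
  | Mul s t => term_eval s (term_eval t w)
  end.

(** The action on W of the algebra presented by r; it does not depend on the
    representative when g satisfies the relations. *)
Definition palg_act (u : palg r) (w : W) : W := term_eval (repr u) w.

Hypothesis g_lin : forall x c v w, g x (c *: v + w) = c *: g x v + g x w.
Hypothesis g_rel : forall s t, r s t -> term_eval s =1 term_eval t.

Lemma term_evalP t c v w :
  term_eval t (c *: v + w) = c *: term_eval t v + term_eval t w.
Proof.
elim: t v w => /= [x|a|t IHt t' IHt'|t IHt t' IHt'] v w.
- exact: g_lin.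
- by rewrite scalerDr !scalerA mulrC.
- by rewrite IHt IHt' scalerDr addrACA.
- by rewrite IHt' IHt.
Qed.

Lemma term_evalD t v w : term_eval t (v + w) = term_eval t v + term_eval t w.
Proof. by have := term_evalP t 1 v w; rewrite !scale1r. Qed.

Lemma term_eval0 t : term_eval t 0 = 0.
Proof. by apply: (addIr (term_eval t 0)); rewrite -term_evalD !add0r. Qed.

Lemma term_evalZ t c v : term_eval t (c *: v) = c *: term_eval t v.
Proof. by have := term_evalP t c v 0; rewrite term_eval0 !addr0. Qed.

Lemma term_eval_cong s t : cong r s t -> term_eval s =1 term_eval t.
Proof.
elim=> {s t} /=.
- exact: g_rel.
- by [].
- by move=> s t _ IH w; rewrite IH.
- by move=> s t u _ IH _ IH' w; rewrite IH.
- by move=> s s' t t' _ IH _ IH' w; rewrite IH IH'.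
- by move=> s s' t t' _ IH _ IH' w; rewrite IH IH'.
- by move=> s t u w; rewrite addrA.
- by move=> s t w; rewrite addrC.
- by move=> s w; rewrite scale0r add0r.
- by [].
- by move=> s w; rewrite scale1r.
- by move=> s w; rewrite !scale0r.
- by [].
- by move=> s t u w; rewrite term_evalD.
- by move=> a b w; rewrite scalerDl.
- by move=> a b w; rewrite scalerA.
- by move=> a s w; rewrite term_evalZ.
Qed.

Lemma palg_actE t w : palg_act (pclass r t) w = term_eval t w.
Proof. by apply: term_eval_cong; exact: cong_repr. Qed.

Lemma palg_actP u c v w :
  palg_act u (c *: v + w) = c *: palg_act u v + palg_act u w.
Proof. exact: term_evalP. Qed.

Lemma palg_act0 u : palg_act u 0 = 0.
Proof. exact: term_eval0. Qed.

Lemma palg_actD u v w : palg_act u (v + w) = palg_act u v + palg_act u w.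
Proof. exact: term_evalD. Qed.

Lemma palg_actN u v : palg_act u (- v) = - palg_act u v.
Proof. by rewrite -scaleN1r [LHS]term_evalZ scaleN1r.
Qed.

Lemma palg_actDl u v w : palg_act (u + v) w = palg_act u w + palg_act v w.
Proof.
by elim/palgW: u => s; elim/palgW: v => t; rewrite [_ + _]paddE !palg_actE.
Qed.

Lemma palg_actM u v w : palg_act (u * v) w = palg_act u (palg_act v w).
Proof.
by elim/palgW: u => s; elim/palgW: v => t; rewrite [_ * _]pmulE !palg_actE.
Qed.

Lemma palg_act1 w : palg_act 1 w = w.
Proof. by rewrite palg_actE /= scale1r. Qed.

Lemma palg_actZl c u w : palg_act (c *: u) w = c *: palg_act u w.
Proof. by elim/palgW: u => s; rewrite [_ *: _]pscaleE !palg_actE. Qed.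

Lemma palg_act_sum n (u : 'I_n -> palg r) w :
  palg_act (\sum_(i < n) u i) w = \sum_(i < n) palg_act (u i) w.
Proof.
elim: n u => [|n IH] u; first by rewrite !big_ord0 palg_actE /= scale0r.
by rewrite !big_ord_recl palg_actDl IH.
Qed.

End PresentedAction.

Lemma palg_scalerAr (K : fieldType) (X : Type)
    (r : term K X -> term K X -> Prop) (c : K) (u v : palg r) :
  c *: (u * v) = u * (c *: v).
Proof.
elim/palgW: u => s; elim/palgW: v => t.
rewrite [_ * _]pmulE [LHS]pscaleE [_ *: _]pscaleE [RHS]pmulE; apply/pclassP.
apply: cong_trans (cong_mulA _ _ _ _) _.
apply: cong_trans (cong_mul (cong_constC _ _ _) (cong_refl _ _)) _.
exact/cong_sym/cong_mulA.
Qed.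

Lemma pclass_Const (K : fieldType) (X : Type)
    (r : term K X -> term K X -> Prop) (c : K) :
  pclass r (Const _ c) = c *: (1 : palg r).
Proof.
rewrite [RHS]pscaleE; apply/pclassP/cong_sym.
exact: cong_trans (cong_constC _ _ _) (cong_mul1 _ _).
Qed.

Lemma iter_can (T : Type) (f g : T -> T) k :
  cancel f g -> cancel (iter k f) (iter k g).
Proof. by move=> fK; elim: k => // k IH x; rewrite iterSr iterS fK IH. Qed.

Section EnvelopingAction.
Variables (K : fieldType) (n : nat).

Lemma U_ofP c (A B : sl K n) : U_of (c *: A + B) = c *: U_of A + U_of B.
Proof.
by rewrite [c *: U_of A]pscaleE [RHS]paddE; apply/pclassP/cong_rel/U_lin.
Qed.

Lemma U_of_bracket (A B : sl K n) :
  U_of (bracket A B) = U_of A * U_of B - U_of B * U_of A.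
Proof.
rewrite [_ * _]pmulE [X in _ - X]pmulE [- _]pscaleE [RHS]paddE.
exact/pclassP/cong_rel/U_bracket.
Qed.

Variables (M : lmodType K) (rho : sl K n -> M -> M).
Hypothesis rhoP : is_gmodule rho.

Let rho_rel s t : U_rel s t -> term_eval rho s =1 term_eval rho t.
Proof.
by move=> h; apply: (term_act_cong rhoP); exact: cong_rel.
Qed.

Lemma U_act_of A m : U_act rho (U_of A) m = rho A m.
Proof. by rewrite U_actE. Qed.

Lemma U_act1 m : U_act rho 1 m = m.
Proof. by rewrite U_actE //= scale1r. Qed.

Lemma U_actM u v m : U_act rho (u * v) m = U_act rho u (U_act rho v m).
Proof. by apply: (palg_actM (g := rho)) => //; exact: gmodP. Qed.

Lemma U_actDl u v m : U_act rho (u + v) m = U_act rho u m + U_act rho v m.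
Proof. by apply: (palg_actDl (g := rho)) => //; exact: gmodP. Qed.

Lemma U_actZl c u m : U_act rho (c *: u) m = c *: U_act rho u m.
Proof. by apply: (palg_actZl (g := rho)) => //; exact: gmodP. Qed.

Lemma U_actP u c v w :
  U_act rho u (c *: v + w) = c *: U_act rho u v + U_act rho u w.
Proof. by apply: (palg_actP (g := rho)); exact: gmodP. Qed.

Lemma U_act_expf A i m : U_act rho (U_of A ^+ i) m = iter i (rho A) m.
Proof.
elim: i m => [|i IH] m; first by rewrite expr0 U_act1.
by rewrite exprS U_actM IH U_act_of.
Qed.

Lemma U_act_equivariant (W : lmodType K) (tau : sl K n -> W -> W)
    (iota : {linear M -> W}) u m :
  (forall A m, iota (rho A m) = tau A (iota m)) ->
  iota (U_act rho u m) = U_act tau u (iota m).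
Proof.
move=> iotaE; rewrite /U_act.
elim: (repr u) m => /= [A|c|s IHs t IHt|s IHs t IHt] m.
- exact: iotaE.
- by rewrite linearZ.
- by rewrite linearD IHs IHt.
- by rewrite IHs IHt.
Qed.

End EnvelopingAction.

(** * The localized module *)

Section LocalizedAlgebra.
Variables (K : fieldType) (n : nat) (f : sl K n).
Notation D := (DfU f).
Notation fD := (DfU_of f (U_of f) : D).

Lemma DfU_ofP c u v : DfU_of f (c *: u + v) = c *: DfU_of f u + DfU_of f v.
Proof.
rewrite [c *: DfU_of _ _]pscaleE [RHS]paddE.
exact/pclassP/cong_rel/loc_lin.
Qed.

Lemma DfU_of1 : DfU_of f 1 = 1.
Proof. exact/pclassP/cong_rel/loc_one. Qed.

Lemma DfU_ofM u v : DfU_of f (u * v) = DfU_of f u * DfU_of f v.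
Proof. by rewrite [RHS]pmulE; apply/pclassP/cong_rel/loc_mul. Qed.

Lemma DfU_ofD u v : DfU_of f (u + v) = DfU_of f u + DfU_of f v.
Proof. by have := DfU_ofP 1 u v; rewrite !scale1r. Qed.

Lemma DfU_of0 : DfU_of f 0 = 0.
Proof. by apply: (addIr (DfU_of f 0)); rewrite -DfU_ofD !add0r. Qed.

Lemma DfU_ofZ c u : DfU_of f (c *: u) = c *: DfU_of f u.
Proof. by have := DfU_ofP c u 0; rewrite DfU_of0 !addr0. Qed.

Lemma DfU_ofB u v : DfU_of f (u - v) = DfU_of f u - DfU_of f v.
Proof. by rewrite DfU_ofD -scaleN1r DfU_ofZ scaleN1r. Qed.

Lemma U_of0 : U_of (0 : sl K n) = 0.
Proof.
have := U_ofP 1 (0 : sl K n) 0; rewrite !scale1r addr0 => e.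
by apply: (addIr (U_of 0)); rewrite -e add0r.
Qed.

Lemma DfU_of_exp u i : DfU_of f (u ^+ i) = DfU_of f u ^+ i.
Proof. by elim: i => [|i IH]; rewrite ?expr0 ?DfU_of1 // !exprS DfU_ofM IH. Qed.

Lemma mulr_f_inv i : fD ^+ i * f_inv f i = 1.
Proof.
rewrite -DfU_of_exp [LHS]pmulE.
apply: (proj2 (pclassP _ _ _)); apply: cong_rel.
exact: (loc_mulV (exist _ _ (ex_intro _ i erefl))).
Qed.

Lemma f_inv_mulr i : f_inv f i * fD ^+ i = 1.
Proof.
rewrite -DfU_of_exp [LHS]pmulE.
apply: (proj2 (pclassP _ _ _)); apply: cong_rel.
exact: (loc_Vmul (exist _ _ (ex_intro _ i erefl))).
Qed.

Lemma ad_DfU_of A : ad fD (DfU_of f (U_of A)) = DfU_of f (U_of (bracket f A)).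
Proof. by rewrite U_of_bracket DfU_ofB !DfU_ofM. Qed.

Lemma iter_ad i A :
  iter i (ad fD) (DfU_of f (U_of A)) = DfU_of f (U_of (iter i (bracket f) A)).
Proof. by elim: i => //= i ->; exact: ad_DfU_of. Qed.

Lemma Theta_ad3 x A : bracket f (bracket f (bracket f A)) = 0 ->
  Theta x (DfU_of f (U_of A)) =
  \sum_(i < 3)
    gbinom x i *: (DfU_of f (U_of (iter i (bracket f) A)) * f_inv f i).
Proof.
move=> A3; rewrite /Theta; under eq_fsbigr do rewrite iter_ad.
rewrite (fsbig_ord _ _ (fun i =>
  gbinom x i *: (DfU_of f (U_of (iter i (bracket f) A)) * f_inv f i))).
apply/esym/fsbig_widen => // i [_ /= /negP]; rewrite -leqNgt => i3.
have -> : iter i (bracket f) A = 0.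
  rewrite -(subnK i3) iterD /= A3.
  by elim: (i - 3)%N => //= k ->; rewrite bracketf0.
by rewrite U_of0 DfU_of0 mul0r scaler0.
Qed.

End LocalizedAlgebra.

Section LocalizedModule.
Variables (K : fieldType) (n : nat) (M : lmodType K) (rho : sl K n -> M -> M).
Variable f : sl K n.
Hypothesis rhoP : is_gmodule rho.
Hypothesis adf3 : forall A, bracket f (bracket f (bracket f A)) = 0.
Notation D := (DfU f).
Notation fD := (DfU_of f (U_of f) : D).
Notation DM := (DfM rho f).
Notation pureM d m := (pure (DfU_of f) (U_act rho) d m : DM).
Notation act d u := (tensor_act d u : DM).
Notation ftimes := (tensor_act (j := DfU_of f) (act := U_act rho) fD).

Lemma pureDr d m m' : pureM d (m + m') = pureM d m + pureM d m'.
Proof. by rewrite [RHS]taddE; apply/tclassP/tcong_pureDr. Qed.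

Lemma pure0 d : pureM d 0 = 0.
Proof. by apply: (addIr (pureM d 0)); rewrite -pureDr !add0r. Qed.

Lemma act_pure1 a m : act (DfU_of f a) (pureM 1 m) = pureM 1 (U_act rho a m).
Proof.
rewrite tensor_act_pure mulr1 -[DfU_of f a]mul1r.
exact/tclassP/tcong_balanced.
Qed.

Lemma act_scale (c : K) u : act (c *: (1 : D)) u = c *: u.
Proof. by []. Qed.

Lemma act0l u : act (0 : D) u = 0.
Proof. by apply: (addIr (act (0 : D) u)); rewrite -tensor_actDl !add0r. Qed.

Lemma act_iter i u : act (fD ^+ i) u = iter i ftimes u.
Proof.
elim: i u => [|i IH] u; first by rewrite expr0 tensor_act1.
by rewrite exprS -tensor_actM IH.
Qed.

(** The vector u of the localized module is a fraction f ^ (- k) m, with m in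
    the image of M. *)
Definition has_numerator (u : DM) := exists k m, iter k ftimes u = pureM 1 m.

Lemma ftimes_pure1 m : ftimes (pureM 1 m) = pureM 1 (rho f m).
Proof. by rewrite act_pure1 U_act_of. Qed.

Lemma iter_ftimes_pure1 k m :
  iter k ftimes (pureM 1 m) = pureM 1 (iter k (rho f) m).
Proof. by elim: k => //= k ->; rewrite ftimes_pure1. Qed.

Lemma iter_ftimesD k u v :
  iter k ftimes (u + v) = iter k ftimes u + iter k ftimes v.
Proof. by rewrite -!act_iter tensor_actD. Qed.

Lemma has_numeratorD u v :
  has_numerator u -> has_numerator v -> has_numerator (u + v).
Proof.
move=> [k [m e]] [l [m' e']].
exists (k + l)%N, (iter l (rho f) m + iter k (rho f) m').
rewrite iter_ftimesD pureDr -!iter_ftimes_pure1 -e -e' -!iterD.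
by rewrite [in X in X + _]addnC.
Qed.

Lemma has_numerator_ftimes u : has_numerator (ftimes u) -> has_numerator u.
Proof. by move=> [k [m e]]; exists k.+1, m; rewrite iterSr. Qed.

Lemma has_numerator_scale c u : has_numerator u -> has_numerator (c *: u).
Proof.
move=> [k [m e]]; exists k, (c *: m).
have -> : pureM 1 (c *: m) = c *: pureM 1 m.
  rewrite -[in LHS](U_act1 rhoP m) -(U_actZl rhoP) -act_pure1 DfU_ofZ DfU_of1.
  exact: act_scale.
rewrite -e -!act_iter -!act_scale !tensor_actM.
by rewrite -palg_scalerAl -palg_scalerAr mul1r mulr1.
Qed.

Lemma has_numerator0 : has_numerator 0.
Proof. by exists 0, 0; rewrite pure0. Qed.

Lemma ftimes_act A u : ftimes (act (DfU_of f (U_of A)) u) =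
  act (DfU_of f (U_of A)) (ftimes u) + act (DfU_of f (U_of (bracket f A))) u.
Proof.
by rewrite !tensor_actM -tensor_actDl -ad_DfU_of /ad addrC subrK.
Qed.

(** The Ore condition, by induction on the nilpotency degree of A under ad f,
    then on the power of f that clears the denominator of u. *)
Lemma has_numerator_act_of A u :
  has_numerator u -> has_numerator (act (DfU_of f (U_of A)) u).
Proof.
have [j Aj] : exists j, iter j (bracket f) A = 0 by exists 3; exact: adf3.
elim: j A u Aj => [|j IHj] A u.
  move=> /= -> _; rewrite U_of0 DfU_of0 act0l; exact: has_numerator0.
rewrite iterSr => A0 [k [m e]]; elim: k u e => [|k IHk] u e.
  by exists 0, (rho A m); move: e => /= ->; rewrite act_pure1 U_act_of.
apply: has_numerator_ftimes; rewrite ftimes_act; apply: has_numeratorD.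
  by apply: IHk; rewrite -iterSr.
by apply: IHj => //; exists k.+1, m.
Qed.

Lemma has_numerator_iter i u :
  has_numerator (iter i ftimes u) -> has_numerator u.
Proof. by elim: i => //= i IH /has_numerator_ftimes. Qed.

Lemma has_numerator_act d u : has_numerator u -> has_numerator (act d u).
Proof.
rewrite -(pclassK d); elim: (repr d) u => [x|c|s IHs t IHt|s IHs t IHt] u hu.
- case: x => [a|s].
    rewrite -(pclassK a).
    elim: (repr a) u hu => [A|c|s IHs t IHt|s IHs t IHt] u hu.
    + exact: has_numerator_act_of.
    + rewrite pclass_Const -[pclass _ _]/(DfU_of f _) DfU_ofZ DfU_of1.
      exact: has_numerator_scale.
    + rewrite -paddE -[pclass _ _]/(DfU_of f (_ + _)) DfU_ofD tensor_actDl.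
      by apply: has_numeratorD; [exact: IHs|exact: IHt].
    + rewrite -pmulE -[pclass _ _]/(DfU_of f (_ * _)) DfU_ofM -tensor_actM.
      exact/IHs/IHt.
  have [i si] := svalP s.
  apply: (@has_numerator_iter i).
  rewrite -act_iter tensor_actM -DfU_of_exp -si.
  have -> : DfU_of f (sval s)
      * pclass (loc_rel (S := f_powers f)) (Var K (inr s)) = 1.
    by rewrite [LHS]pmulE; apply/pclassP/cong_rel/loc_mulV.
  by rewrite tensor_act1.
- by rewrite pclass_Const; exact: has_numerator_scale.
- rewrite -paddE tensor_actDl.
  by apply: has_numeratorD; [exact: IHs|exact: IHt].
- by rewrite -pmulE -tensor_actM; apply/IHs/IHt.
Qed.

Lemma has_numeratorT u : has_numerator u.
Proof.
elim/tensor_ind: u => [|d m|u hu|u v hu hv].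
- exact: has_numerator0.
- rewrite -[d]mulr1 -tensor_act_pure; apply: has_numerator_act.
  by exists 0, m.
- by rewrite -scaleN1r; exact: has_numerator_scale.
- exact: has_numeratorD.
Qed.

Lemma ftimes_inj : injective ftimes.
Proof.
apply: (can_inj (g := fun u => act (f_inv f 1) u)) => u.
by rewrite tensor_actM -[X in _ * X]expr1 f_inv_mulr tensor_act1.
Qed.

Variables (W : lmodType K) (tau : sl K n -> W -> W).
Hypothesis tauP : is_gmodule tau.
Variable iota : {linear M -> W}.
Hypothesis iota_inj : injective iota.
Hypothesis iotaE : forall A m, iota (rho A m) = tau A (iota m).
Variable Fi : W -> W.
Hypotheses (FK : cancel (tau f) Fi) (FiK : cancel Fi (tau f)).
Hypothesis loc : forall w, exists k m, iter k (tau f) w = iota m.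

(** An exponent i such that s = f ^ i; it need not be unique, but the inverse of
    f ^ i only depends on s. *)
Definition den (s : {a : Ug K n | f_powers f a}) : {i | sval s = U_of f ^+ i} :=
  cid (svalP s).

(** The operators by which the generators of D_f U act on W. *)
Definition loc_gen_act (x : loc_gen (f_powers f)) : W -> W :=
  match x with
  | inl a => U_act tau a
  | inr s => iter (sval (den s)) Fi
  end.

Let Fi_lin c v w : Fi (c *: v + w) = c *: Fi v + Fi w.
Proof. by apply: (can_inj FK); rewrite (gmodP tauP) !FiK. Qed.

Let gen_lin x c v w :
  loc_gen_act x (c *: v + w) = c *: loc_gen_act x v + loc_gen_act x w.
Proof.
case: x => [a|s] /=; first exact: U_actP.
by elim: (sval _) => //= i ->; rewrite Fi_lin.
Qed.

Let gen_rel s t : @loc_rel _ _ _ (f_powers f) s t ->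
  term_eval loc_gen_act s =1 term_eval loc_gen_act t.
Proof.
case=> {s t} [c u v|//|u v|s|s] w /=.
- by rewrite U_actDl // U_actZl.
- by rewrite U_act1 // scale1r.
- by rewrite U_actM.
- rewrite {1}(svalP (den s)) U_act_expf // scale1r.
  exact: iter_can.
- rewrite {2}(svalP (den s)) U_act_expf // scale1r.
  exact: iter_can.
Qed.

(** The action of D_f U on W, where f is invertible. *)
Definition Dact (d : D) (w : W) : W := palg_act loc_gen_act d w.

Lemma Dact_DfU_of a w : Dact (DfU_of f a) w = U_act tau a w.
Proof. by rewrite /Dact palg_actE. Qed.

Lemma Dact_f_inv i w : Dact (f_inv f i) w = iter i Fi w.
Proof.
apply: (can_inj (iter_can i FK)); rewrite (iter_can i FiK).
rewrite -(U_act_expf tauP) -Dact_DfU_of DfU_of_exp /Dact -palg_actM //.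
by rewrite mulr_f_inv palg_act1.
Qed.

Let DactM d d' w : Dact (d * d') w = Dact d (Dact d' w).
Proof. exact: palg_actM. Qed.

Let DactDl d d' w : Dact (d + d') w = Dact d w + Dact d' w.
Proof. exact: palg_actDl. Qed.

Fixpoint tterm_map (t : tterm (loc_rel (S := f_powers f)) M) : W :=
  match t with
  | TZero => 0
  | TPure d m => Dact d (iota m)
  | TOpp t => - tterm_map t
  | TAdd s t => tterm_map s + tterm_map t
  end.

Lemma tterm_map_cong s t :
  tcong (DfU_of f) (U_act rho) s t -> tterm_map s = tterm_map t.
Proof.
elim=> {s t} /=.
- by [].
- by move=> s t _ ->.
- by move=> s t u _ -> _ ->.
- by move=> s s' t t' _ -> _ ->.
- by move=> s s' _ ->.
- by move=> s t u; rewrite addrA.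
- by move=> s t; rewrite addrC.
- by move=> s; rewrite add0r.
- by move=> s; rewrite addNr.
- by move=> d d' m; rewrite DactDl.
- by move=> d m m'; rewrite linearD; exact: palg_actD.
- move=> d a m; rewrite DactM Dact_DfU_of.
  by rewrite (U_act_equivariant a m iotaE).
Qed.

(** The map d (x) m |-> d (iota m) from the localized module to W. *)
Definition DfM_map (u : DM) : W := tterm_map (repr u).

Lemma DfM_mapE t : DfM_map (tclass (DfU_of f) (U_act rho) t) = tterm_map t.
Proof. exact/tterm_map_cong/tcong_repr. Qed.

Lemma DfM_map_pure d m : DfM_map (pureM d m) = Dact d (iota m).
Proof. exact: DfM_mapE. Qed.

Lemma DfM_mapD u v : DfM_map (u + v) = DfM_map u + DfM_map v.
Proof.
elim/tensorW: u => s; elim/tensorW: v => t.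
by rewrite [_ + _]taddE !DfM_mapE.
Qed.

Lemma DfM_map_act d u : DfM_map (act d u) = Dact d (DfM_map u).
Proof.
elim/tensorW: u => t; rewrite tensor_actE !DfM_mapE.
elim: t => [|d' m|t IH|s IHs t IHt] /=.
- by rewrite /Dact palg_act0.
- exact: DactM.
- by rewrite IH /Dact palg_actN.
- by rewrite IHs IHt /Dact palg_actD.
Qed.

Lemma DfM_mapZ c u : DfM_map (c *: u) = c *: DfM_map u.
Proof.
rewrite -act_scale DfM_map_act /Dact palg_actZl //.
by rewrite palg_act1.
Qed.

Lemma DfM_mapP c u v : DfM_map (c *: u + v) = c *: DfM_map u + DfM_map v.
Proof. by rewrite DfM_mapD DfM_mapZ. Qed.

Let Dact_fD w : Dact fD w = tau f w.
Proof. by rewrite Dact_DfU_of U_act_of. Qed.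

Lemma DfM_map_iter k u : DfM_map (iter k ftimes u) = iter k (tau f) (DfM_map u).
Proof. by elim: k => //= k IH; rewrite DfM_map_act Dact_fD IH. Qed.

Lemma DfM_map_inj : injective DfM_map.
Proof.
suff inj0 u : DfM_map u = 0 -> u = 0.
  move=> u v e; apply/eqP; rewrite -subr_eq0; apply/eqP/inj0.
  by rewrite -scaleN1r DfM_mapD DfM_mapZ scaleN1r e subrr.
move=> u0; have [k [m e]] := has_numeratorT u.
have m0 : m = 0.
  apply: iota_inj; rewrite linear0.
  have <- : DfM_map (pureM 1 m) = iota m.
    by rewrite DfM_map_pure /Dact palg_act1.
  rewrite -e DfM_map_iter u0; elim: k {e} => //= k ->.
  exact: gmod0.
move: e; rewrite m0 pure0; elim: k => //= k IH e.
by apply: IH; apply: ftimes_inj; rewrite e tensor_act0.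
Qed.

Lemma DfM_map_surj w : exists u, DfM_map u = w.
Proof.
have [k [m e]] := loc w; exists (pureM (f_inv f k) m).
by rewrite DfM_map_pure Dact_f_inv -e (iter_can k FK).
Qed.

(** The map intertwines the twisted action with the first terms of the series
    defining Theta. *)
Lemma DfM_map_twisted x A u : DfM_map (twisted_act rho f x A u) =
  tau A (DfM_map u) + x *: tau (bracket f A) (Fi (DfM_map u))
  + gbinom x 2 *: tau (bracket f (bracket f A)) (Fi (Fi (DfM_map u))).
Proof.
rewrite /twisted_act DfM_map_act Theta_ad3 // {1}/Dact palg_act_sum //.
rewrite !big_ord_recl big_ord0 addr0 /= addrA.
rewrite !palg_actZl // !palg_actM // -!/(Dact _ _) !Dact_f_inv !Dact_DfU_of.
by rewrite !U_act_of // gbinom0 gbinom1 scale1r.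
Qed.

(** The twisted localization of M is isomorphic to W with any action given by
    the series defining Theta. *)
Lemma DfM_iso (sigma : K -> sl K n -> W -> W) x :
  (forall A w, sigma x A w = tau A w + x *: tau (bracket f A) (Fi w)
     + gbinom x 2 *: tau (bracket f (bracket f A)) (Fi (Fi w))) ->
  is_gmodule (sigma x) ->
  is_gmodule (twisted_act rho f x) /\
  gmodule_iso (sigma x) (twisted_act rho f x).
Proof.
move=> sigmaE sigmaP.
have mapE A u : DfM_map (twisted_act rho f x A u) = sigma x A (DfM_map u).
  by rewrite DfM_map_twisted sigmaE.
split.
  split=> [A c v w|c A B v|A B v]; apply: DfM_map_inj.
  - by rewrite !(mapE, DfM_mapP) (gmodP sigmaP).
  - by rewrite !(mapE, DfM_mapP) (gmodDl sigmaP) (gmodZl sigmaP).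
  - rewrite -scaleN1r DfM_mapD DfM_mapZ scaleN1r !mapE.
    exact: gmod_bracket.
pose G w := sval (cid (DfM_map_surj w)).
have mapG w : DfM_map (G w) = w := svalP (cid (DfM_map_surj w)).
have G_lin : linear G.
  by move=> c u v; apply: DfM_map_inj; rewrite DfM_mapP !mapG.
pose hL := GRing.isLinear.Build _ _ _ _ G G_lin.
pose GL : {linear W -> DM} := HB.pack G hL.
exists GL.
  exists DfM_map => u; first exact: mapG.
  by apply: DfM_map_inj; exact: mapG.
by move=> A w; apply: DfM_map_inj; rewrite mapE /= !mapG.
Qed.

End LocalizedModule.

(** * Linear maps on spaces with a basis *)

Section LinearExtension.
Variables (K : fieldType) (T : choiceType) (W : lmodType K) (e : T -> W).

(** The linear map with prescribed values on the basis T. *)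
Definition malg_ext (m : {malg K[T]}) : W :=
  \sum_(t <- msupp m) m@_t *: e t.

Lemma malg_extEw (D : {fset T}) (m : {malg K[T]}) :
  (msupp m `<=` D)%fset -> malg_ext m = \sum_(t <- D) m@_t *: e t.
Proof.
move=> mD; rewrite /malg_ext (big_fset_incl _ mD) // => t _ tm.
by rewrite mcoeff_outdom // scale0r.
Qed.

Lemma malg_ext_linear : linear malg_ext.
Proof.
move=> c u v; pose D := (msupp u `|` msupp v)%fset.
have uD : (msupp u `<=` D)%fset by exact: fsubsetUl.
have vD : (msupp v `<=` D)%fset by exact: fsubsetUr.
have wD : (msupp (c *: u + v) `<=` D)%fset.
  apply: fsubset_trans (msuppD_le _ _) _; rewrite fsubUset vD andbT.
  exact: fsubset_trans (msuppZ_le _ _) uD.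
rewrite (malg_extEw uD) (malg_extEw vD) (malg_extEw wD) scaler_sumr -big_split.
by apply: eq_bigr => t _; rewrite mcoeffD mcoeffZ scalerDl scalerA.
Qed.

HB.instance Definition _ :=
  GRing.isLinear.Build K {malg K[T]} W _ malg_ext malg_ext_linear.

Lemma malg_extU t : malg_ext (mkmalgU t 1) = e t.
Proof.
rewrite (malg_extEw (D := [fset t]%fset)); last exact: msuppU_le.
by rewrite big_seq_fset1 mcoeffUU scale1r.
Qed.

Lemma mkmalgUZ t (c : K) : mkmalgU t c = c *: mkmalgU t 1 :> {malg K[T]}.
Proof.
apply/malgP => s; rewrite mcoeffZ !mcoeffU.
by case: (t == s); rewrite ?mulr1 ?mulr0.
Qed.

Lemma eq_malg_linear (h1 h2 : {linear {malg K[T]} -> W}) :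
  (forall t, h1 (mkmalgU t 1) = h2 (mkmalgU t 1)) -> h1 =1 h2.
Proof.
move=> h m; rewrite [m]monalgE !linear_sum; apply: eq_bigr => t _.
by rewrite mkmalgUZ !linearZZ h.
Qed.

End LinearExtension.

(** * The entry (1, 1) in the Gelfand-Tsetlin coefficients *)

Section Vertices.
Variables (n : nat) (K : fieldType).
Implicit Types (a b : vertex n) (w : tableau n K).

Lemma row_gt0 a : (0 < row_of a)%N.
Proof. by case/andP: (valP a) => h h2; exact: leq_trans h h2. Qed.

Lemma vertex_subproof i j : (1 <= j <= i)%N -> (i < n.+2)%N ->
  let p : 'I_n.+2 * 'I_n.+2 := (inord i, inord j) in (1 <= p.2 <= p.1)%N.
Proof. by case/andP=> h1 h2 h3 /=; rewrite !inordK ?h1 //; lia. Qed.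

(** The vertex (i, j) of the triangular array. *)
Definition mkvertex i j (hj : (1 <= j <= i)%N) (hi : (i < n.+2)%N) : vertex n :=
  exist _ (inord i, inord j) (vertex_subproof hj hi).

Lemma vertex_eq a b : row_of a = row_of b -> (val a).2 = (val b).2 -> a = b.
Proof.
move=> h1 h2; apply/val_inj; rewrite [val a]surjective_pairing h2.
by rewrite [RHS]surjective_pairing; congr pair; apply/val_inj.
Qed.

Lemma col_range a : (1 <= (val a).2 <= row_of a)%N.
Proof. exact: valP a. Qed.

Lemma row_mkvertex i j hj hi : row_of (@mkvertex i j hj hi) = i.
Proof. by rewrite /row_of /= inordK. Qed.

Lemma col_mkvertex i j hj hi : (val (@mkvertex i j hj hi)).2 = j :> nat.
Proof.
by rewrite /= inordK //; case/andP: hj => _ h; exact: leq_ltn_trans hi.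
Qed.

Definition v11 : vertex n := @mkvertex 1 1 isT isT.

Lemma row_v11 : row_of v11 = 1%N.
Proof. exact: row_mkvertex. Qed.

Lemma row1 a : (row_of a == 1%N) = (a == v11).
Proof.
apply/eqP/eqP => [e|->]; last exact: row_v11.
apply: vertex_eq; first by rewrite row_v11.
apply/val_inj; rewrite /= inordK //.
by have := col_range a; rewrite e; case: (val a).2 => [[|[|k]] hk].
Qed.

Lemma prod_row1 (F : vertex n -> K) : \prod_(b | row_of b == 1%N) F b = F v11.
Proof.
by rewrite (eq_bigl (pred1 v11)) ?big_pred1_eq // => b; rewrite row1.
Qed.

Lemma prod_row0 (F : vertex n -> K) : \prod_(b | row_of b == 0%N) F b = 1.
Proof. by rewrite big_pred0 // => b; apply/negbTE; rewrite -lt0n row_gt0. Qed.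

Lemma prod_row2 : (0 < n)%N -> exists b1 b2 : vertex n,
  [/\ row_of b1 = 2%N, row_of b2 = 2%N &
  forall F : vertex n -> K, \prod_(b | row_of b == 2%N) F b = F b1 * F b2].
Proof.
move=> n0; have h2 : (2 < n.+2)%N by [].
pose b1 := @mkvertex 2 1 isT h2; pose b2 := @mkvertex 2 2 isT h2.
have r1 : row_of b1 = 2%N by exact: row_mkvertex.
have r2 : row_of b2 = 2%N by exact: row_mkvertex.
exists b1, b2; split=> // F.
have b21 : b2 != b1.
  apply/eqP => /(congr1 (fun a => nat_of_ord (val a).2)).
  by rewrite !col_mkvertex.
rewrite (bigD1 b1) ?r1 //= (bigD1 b2) ?r2 ?b21 //= big_pred0 ?mulr1 // => b.
apply/negbTE/negP => /andP[/andP[/eqP e n1] n2].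
have := col_range b; rewrite e => /andP[c1 c2].
have [cb|cb] : nat_of_ord (val b).2 = 1%N \/ nat_of_ord (val b).2 = 2%N by lia.
  case/eqP: n1; apply: vertex_eq; rewrite ?e ?r1 //; apply/val_inj.
  by rewrite [RHS]col_mkvertex.
case/eqP: n2; apply: vertex_eq; rewrite ?e ?r2 //; apply/val_inj.
by rewrite [RHS]col_mkvertex.
Qed.

(** The tableau w with its entry (1, 1) increased by t. *)
Definition shift11 w (t : K) := shift w v11 t.

Lemma shift11E w t b : shift11 w t b = w b + (if b == v11 then t else 0).
Proof. by rewrite ffunE. Qed.

Lemma shift11_row w t b : row_of b != 1%N -> shift11 w t b = w b.
Proof. by rewrite row1 shift11E => /negPf ->; rewrite addr0. Qed.

Lemma shift11_v11 w t : shift11 w t v11 = w v11 + t.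
Proof. by rewrite shift11E eqxx. Qed.

Lemma shift11D w s t : shift11 (shift11 w s) t = shift11 w (s + t).
Proof.
by apply/ffunP => b; rewrite !shift11E -addrA; case: (b == v11); rewrite ?addr0.
Qed.

Lemma shift11_0 w : shift11 w 0 = w.
Proof. by apply/ffunP => b; rewrite shift11E; case: ifP; rewrite addr0. Qed.

Lemma shift_shift11 w a e t : shift (shift11 w t) a e = shift11 (shift w a e) t.
Proof. by apply/ffunP => b; rewrite !ffunE addrAC. Qed.

(** The Gelfand-Tsetlin coefficients are polynomials of degree at most two in
    the entry (1, 1), since row 2 has two entries. *)

Lemma raise_coef_quadratic k w a : (0 < n)%N -> row_of a = k.+1 ->
  quadratic (fun t => raise_coef k.+1 (shift11 w t) a).
Proof.
move=> n0 ra; rewrite /raise_coef.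
case: k ra => [|k] ra.
  have [b1 [b2 [r1 r2 prod2]]] := prod_row2 n0.
  have -> : a = v11 by apply/eqP; rewrite -row1 ra.
  exists ((w v11 - w b1) * (w v11 - w b2)),
    (w v11 - w b1 + (w v11 - w b2)), 1 => t.
  rewrite prod2 big_pred0 => [|b].
    by rewrite shift11_v11 !shift11_row ?r1 ?r2 // invr1; ring.
  by rewrite row1 andbN.
exists (raise_coef k.+2 w a), 0, 0 => t; rewrite !mul0r !addr0 /raise_coef.
congr (_ / _); apply: eq_bigr => b.
  by move=> /eqP rb; rewrite !shift11_row // ?ra ?rb.
by move=> /andP[/eqP rb _]; rewrite !shift11_row // ?ra ?rb.
Qed.

Lemma lower_coef_quadratic k w a : row_of a = k.+1 ->
  quadratic (fun t => lower_coef k.+1 (shift11 w t) a).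
Proof.
move=> ra; rewrite /lower_coef /=.
have den t :
    \prod_(b | (row_of b == k.+1) && (b != a)) (shift11 w t a - shift11 w t b)
    = \prod_(b | (row_of b == k.+1) && (b != a)) (w a - w b).
  case: k ra => [|k] ra.
    have -> : a = v11 by apply/eqP; rewrite -row1 ra.
    by rewrite !big_pred0 // => b; rewrite row1 andbN.
  by apply: eq_bigr => b /andP[/eqP rb _]; rewrite !shift11_row // ?ra ?rb.
set d := \prod_(b | _) (w a - w b) in den.
case: k ra @d den => [|[|k]] ra d den.
- exists (1 / d), 0, 0 => t; rewrite den prod_row0; ring.
- exists ((w a - w v11) / d), (- 1 / d), 0 => t.
  by rewrite den prod_row1 shift11_v11 shift11_row ?ra //; ring.
- exists (\prod_(b | row_of b == k.+2) (w a - w b) / d), 0, 0 => t.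
  rewrite den !mul0r !addr0; congr (_ / _).
  by apply: eq_bigr => b /eqP rb; rewrite !shift11_row // ?ra ?rb.
Qed.

Lemma sum_shift11 w t (P : pred (vertex n)) :
  \sum_(b | P b) shift11 w t b =
  \sum_(b | P b) w b + t * \sum_(b | P b) (b == v11)%:R.
Proof.
rewrite mulr_sumr -big_split; apply: eq_bigr => b _; rewrite shift11E.
by case: (b == v11); rewrite ?mulr1 ?mulr0.
Qed.

Lemma cart_coef_quadratic k w :
  quadratic (fun t => cart_coef k.+1 (shift11 w t)).
Proof.
exists (cart_coef k.+1 w),
  (2%:R * (\sum_(b : vertex n | row_of b == k.+1) (b == v11)%:R)
  - (\sum_(b : vertex n | row_of b == k.+1.-1) (b == v11)%:R)
  - (\sum_(b : vertex n | row_of b == k.+2) (b == v11)%:R)), 0 => t.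
by rewrite /cart_coef !sum_shift11; ring.
Qed.

End Vertices.

(** * Relations that do not involve (1, 1) *)

Section Kets.
Variables (K : fieldType) (n : nat).
Implicit Types (C : {set vertex n * vertex n}) (L w : tableau n K).

Lemma ket_in C L w (h : `[< in_basis C L w >]) :
  ket C L w = mkmalgU (exist _ w h : basis C L) 1.
Proof. by rewrite /ket insubT. Qed.

Lemma ket_out C L w : ~ in_basis C L w -> ket C L w = 0.
Proof. by move=> h; rewrite /ket insubF //; apply/negbTE/asboolPn. Qed.

Lemma ket_neq0 C L w : in_basis C L w -> ket C L w <> 0.
Proof.
move=> /asboolP h; rewrite (ket_in h) => /eqP.
by rewrite monalgU_eq0 oner_eq0.
Qed.

Lemma eq_ket_linear C L (W : lmodType K) (h1 h2 : {linear VC C L -> W}) :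
  (forall w, in_basis C L w -> h1 (ket C L w) = h2 (ket C L w)) -> h1 =1 h2.
Proof.
move=> h; apply: eq_malg_linear => -[w hw].
by have := h w (asboolW hw); rewrite (ket_in hw).
Qed.

Lemma VC_ind C L (P : VC C L -> Prop) :
  P 0 -> (forall u v, P u -> P v -> P (u + v)) ->
  (forall c w, in_basis C L w -> P (c *: ket C L w)) -> forall v, P v.
Proof.
move=> P0 PD PZ v; rewrite [v]monalgE; apply: big_ind => // -[w hw] _.
rewrite mkmalgUZ -ket_in; exact: PZ (asboolW hw).
Qed.

Lemma ket_map_subproof C L C2 L2 (phi : tableau n K -> tableau n K) :
  {h : {linear VC C L -> VC C2 L2} |
    forall w, in_basis C L w -> h (ket C L w) = ket C2 L2 (phi w)}.
Proof.
exists (malg_ext (fun u : basis C L => ket C2 L2 (phi (val u)))).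
move=> w /asboolP h.
by rewrite (ket_in h) /= malg_extU.
Qed.

(** The linear map sending T(w) to T(phi w). *)
Definition ket_map C L C2 L2 phi : {linear VC C L -> VC C2 L2} :=
  sval (ket_map_subproof C L C2 L2 phi).

Lemma ket_mapE C L C2 L2 phi w : in_basis C L w ->
  ket_map C L C2 L2 phi (ket C L w) = ket C2 L2 (phi w).
Proof. exact: (svalP (ket_map_subproof C L C2 L2 phi)). Qed.

Lemma ket_map_all C L C2 L2 phi w :
  (in_basis C2 L2 (phi w) -> in_basis C L w) ->
  ket_map C L C2 L2 phi (ket C L w) = ket C2 L2 (phi w).
Proof.
move=> h; have [wb|wb] := pselect (in_basis C L w); first exact: ket_mapE.
by rewrite (ket_out wb) linear0 ket_out // => /h.
Qed.

End Kets.

Section DropVertex.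
Variables (K : fieldType) (n : nat).
Hypothesis n0 : (0 < n)%N.
Variable C : {set vertex n * vertex n}.
Hypothesis hC : C \subset relations n.
Hypothesis hout : forall b, (v11 n, b) \notin C.
Notation v11 := (v11 n).
Implicit Types (L w : tableau n K) (a b : vertex n).

(** The relations not involving the vertex (1, 1). *)
Definition drop11 : {set vertex n * vertex n} :=
  [set p in C | (p.1 != v11) && (p.2 != v11)].

Lemma drop11P a b :
  reflect [/\ (a, b) \in C, a <> v11 & b <> v11] ((a, b) \in drop11).
Proof.
rewrite !inE /=.
apply: (iffP and3P) => [[h /eqP h1 /eqP h2]|[h h1 h2]]; split=> //.
  exact/eqP.
exact/eqP.
Qed.

Lemma in11_row b : (b, v11) \in C -> row_of b = 2%N /\ Rplus b v11.
Proof.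
move=> h; have := fintype.subsetP hC _ h.
rewrite inE /= /Rplus /Rminus /Rzero row_v11.
have -> : (1 == n.+1)%N = false by rewrite eqSS eq_sym eqn0Ngt n0.
by have := row_gt0 b; case: (row_of b) => [|[|[|k]]] //= _; rewrite ?andbF.
Qed.

Lemma in11_neq b : (b, v11) \in C -> b <> v11.
Proof. by move=> h e; have [] := in11_row h; rewrite e row_v11. Qed.

(** The tableau w satisfies the relations of C with target (1, 1), which bound
    its entry (1, 1) from above. *)
Definition nonneg11 w :=
  forall b, (b, v11) \in C -> exists m : nat, w b - w v11 = m%:R.

Lemma satisfies_drop11 w :
  satisfies C w <-> satisfies drop11 w /\ nonneg11 w.
Proof.
split=> [h|[h h11] a b hab].
  split=> [a b /drop11P[hab _ _]|b hb]; first exact: h.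
  by apply: (h _ _ hb).1; have [_ ->] := in11_row hb.
have av : a <> v11 by move=> e; move: hab; rewrite e (negPf (hout b)).
have [bv|/eqP bv] := eqVneq b v11; last by apply: h; exact/drop11P.
rewrite bv in hab *; have [ra _] := in11_row hab.
by split=> [_|]; [exact: h11|rewrite /Rminus row_v11 ra].
Qed.

Lemma satisfies_shift11 w t :
  satisfies drop11 w -> satisfies drop11 (shift11 w t).
Proof.
move=> h a b hab; have /drop11P[_ /eqP/negPf ha /eqP/negPf hb] := hab.
by rewrite !shift11E ha hb !addr0; exact: h.
Qed.

Lemma in_basis_drop11 L w :
  nonneg11 w -> in_basis drop11 L w <-> in_basis C L w.
Proof.
move=> w11; split=> -[z [h1 h2 h3]]; exists z; split=> //.
  exact/satisfies_drop11.
by case/satisfies_drop11: h3.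
Qed.

Lemma in_basis_sub L w : in_basis C L w -> in_basis drop11 L w.
Proof. by move=> [z [h1 h2 /satisfies_drop11[h3 _]]]; exists z. Qed.

Lemma in_basis_shift11 L w (x y : K) (p : int) : y = x + p%:~R ->
  in_basis drop11 L w -> in_basis drop11 (shift11 L x) (shift11 w y).
Proof.
move=> -> [z [h1 h2 h3]].
exists [ffun b => z b + if b == v11 then p else 0]; split=> [b rb|b|].
- rewrite ffunE h1 // add0r ifF //; by rewrite -row1 rb eqSS eqn0Ngt n0.
- rewrite !shift11E ffunE h2 intrD.
  by case: (b == v11); rewrite ?mulr0z; ring.
- exact: satisfies_shift11.
Qed.

Lemma in_basis_shift11_int L w (p : int) :
  in_basis drop11 L (shift11 w p%:~R) <-> in_basis drop11 L w.
Proof.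
split=> h.
  have := @in_basis_shift11 L _ 0 (- p%:~R) (- p) _ h.
  by rewrite shift11_0 shift11D addrN shift11_0 rmorphN add0r; apply.
have := @in_basis_shift11 L _ 0 p%:~R p _ h.
by rewrite shift11_0 add0r; apply.
Qed.

Lemma in_basis_shift11E L w (x : K) :
  in_basis drop11 (shift11 L x) (shift11 w x) <-> in_basis drop11 L w.
Proof.
split=> h; last by apply: (@in_basis_shift11 L w x x 0) => //; rewrite addr0.
have := @in_basis_shift11 _ _ (- x) (- x) 0 _ h.
by rewrite !shift11D !addrN !shift11_0; apply; rewrite addr0.
Qed.

(** Lowering the entry (1, 1) far enough makes a tableau satisfy the relations
    that involve (1, 1), with room for one more step. *)
Lemma depth11 L w : satisfies C L -> in_basis drop11 L w ->
  exists k, forall b, (b, v11) \in C ->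
    exists m : nat, w b - w v11 + k%:R = m.+1%:R.
Proof.
move=> /satisfies_drop11[_ L11] [z [_ wE _]].
have /choice[p pE] : forall b, exists p : int,
    (b, v11) \in C -> w b - w v11 = p%:~R.
  move=> b; have [hb|hb] := boolP ((b, v11) \in C); last by exists 0.
  have [m e] := L11 b hb; exists (m%:Z + z b - z v11) => _.
  rewrite !wE !(intrD, rmorphN) /= -pmulrn -e; ring.
exists (\max_b `|p b|%N).+1 => b hb; rewrite (pE b hb).
have : (`|p b| <= \max_b `|p b|)%N by exact: leq_bigmax.
set k := (\max_b _)%N => pk; exists (absz (p b + k%:Z)).
rewrite !pmulrn -intrD; congr (_%:~R); lia.
Qed.

End DropVertex.

(** * Twisted localization of a relation module *)

Lemma quadratic_translate (K : fieldType) (g : K -> K) c :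
  quadratic g -> quadratic (fun t => g (t - c)).
Proof.
move=> [c0 [c1 [c2 gE]]].
exists (c0 - c1 * c + c2 * c ^+ 2), (c1 - c2 * c *+ 2), c2 => t.
by rewrite gE; ring.
Qed.

Section LocalizeGT.
Variables (K : fieldType) (n : nat).
Hypothesis char0 : [pchar K] =i pred0.
Hypothesis n0 : (0 < n)%N.
Variable C : {set vertex n * vertex n}.
Hypothesis hC : C \subset relations n.
Hypothesis hout : forall b, (v11 n, b) \notin C.
Variable L : tableau n K.
Hypothesis hL : satisfies C L.
Variable rho : sl K n -> VC C L -> VC C L.
Hypotheses (rhoP : is_gmodule rho) (rho_gt : gt_action rho).
Variable x : K.
Notation v11 := (v11 n).
Notation f := (lower K (Ordinal n0)).
Notation C' := (drop11 C).
Notation L' := (shift11 L x).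
Notation W := (VC C' L').
Implicit Types (w : tableau n K) (a b : vertex n).

Let drop_int w (p : int) :
  in_basis C' L' (shift11 w p%:~R) <-> in_basis C' L' w.
Proof. exact: in_basis_shift11_int. Qed.

Lemma lower11 w : in_basis C L w ->
  rho f (ket C L w) = ket C L (shift11 w (- 1)).
Proof.
move=> hw; have [_ -> _] := rho_gt (Ordinal n0) hw.
rewrite (eq_bigl (pred1 v11)) ?big_pred1_eq => [|b]; last by rewrite row1.
rewrite /lower_coef prod_row0 big_pred0 => [|b]; last by rewrite row1 andbN.
by rewrite divr1 scale1r.
Qed.

Let nonneg w : in_basis C L w -> nonneg11 C w.
Proof. by move=> [z [_ _ /(satisfies_drop11 n0 hC hout)[]]]. Qed.

(** The inclusion of V_C(L) into V_C'(L + x); here + x increases the entry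
    (1, 1) by x. *)
Definition embed11 : {linear VC C L -> W} :=
  ket_map C L C' L' (fun w => shift11 w x).

Lemma embed11_ket w :
  nonneg11 C w -> embed11 (ket C L w) = ket C' L' (shift11 w x).
Proof.
move=> w11; apply: ket_map_all => /(in_basis_shift11E n0) h.
exact/in_basis_drop11/h.
Qed.

(** The extension of f to V_C'(L + x), and its inverse. *)
Definition down11 : {linear W -> W} :=
  ket_map C' L' C' L' (fun w => shift11 w (- 1)).
Definition up11 : {linear W -> W} :=
  ket_map C' L' C' L' (fun w => shift11 w 1).

Lemma down11_ket w : down11 (ket C' L' w) = ket C' L' (shift11 w (- 1)).
Proof. by apply: ket_map_all; rewrite -[- 1]/((- 1)%:~R) => /drop_int. Qed.

Lemma up11_ket w : up11 (ket C' L' w) = ket C' L' (shift11 w 1).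
Proof. by apply: ket_map_all; rewrite -[1]/(1%:~R) => /drop_int. Qed.

Lemma down11K : cancel down11 up11.
Proof.
apply: (eq_ket_linear (h1 := up11 \o down11) (h2 := idfun)) => w _ /=.
by rewrite down11_ket up11_ket shift11D addNr shift11_0.
Qed.

Lemma up11K : cancel up11 down11.
Proof.
apply: (eq_ket_linear (h1 := down11 \o up11) (h2 := idfun)) => w _ /=.
by rewrite up11_ket down11_ket shift11D addrN shift11_0.
Qed.

Lemma iter_down11_ket k w :
  iter k down11 (ket C' L' w) = ket C' L' (shift11 w (- k%:R)).
Proof.
elim: k => [|k IH] /=; first by rewrite oppr0 shift11_0.
by rewrite IH down11_ket shift11D -opprD natr1.
Qed.

Lemma embed11_inj : injective embed11.
Proof.
pose r : {linear W -> VC C L} := ket_map C' L' C L (fun w => shift11 w (- x)).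
apply: (can_inj (g := r)).
apply: (eq_ket_linear (h1 := r \o embed11) (h2 := idfun)) => w hw /=.
rewrite embed11_ket; last exact: nonneg.
rewrite /r ket_mapE; first by rewrite shift11D addrN shift11_0.
exact/in_basis_shift11E/in_basis_sub.
Qed.

Lemma down11_embed m : down11 (embed11 m) = embed11 (rho f m).
Proof.
pose hf := GRing.isLinear.Build K (VC C L) (VC C L) _ (rho f) (gmodP rhoP f).
pose rf : {linear VC C L -> VC C L} := HB.pack (rho f) hf.
apply: (eq_ket_linear (h1 := down11 \o embed11) (h2 := embed11 \o rf)).
move=> w hw /=.
rewrite embed11_ket; last exact: nonneg.
rewrite lower11 // down11_ket embed11_ket ?shift11D 1?addrC // => b hb.
have [m' e] := nonneg hw hb; exists m'.+1.
rewrite shift11_v11 shift11_row ?(in11_row n0 hC hb).1 //.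
by rewrite opprD opprK addrA e natr1.
Qed.

Lemma in_basis_deep w k j : in_basis C' L w ->
  (forall b, (b, v11) \in C -> exists m : nat, w b - w v11 + k%:R = m.+1%:R) ->
  in_basis C L (shift11 w (- (k + j)%:R)).
Proof.
move=> hw hk; apply/in_basis_drop11 => //; last first.
  rewrite -[_%:R]/((k + j)%:Z%:~R) -rmorphN.
  exact/in_basis_shift11_int.
move=> b hb; have [m e] := hk b hb; exists (m.+1 + j)%N.
rewrite shift11_v11 shift11_row ?(in11_row n0 hC hb).1 //.
by rewrite opprD opprK natrD addrA addrA e natrD.
Qed.

Lemma iter_down11_deep w k : in_basis C' L w ->
  (forall b, (b, v11) \in C -> exists m : nat, w b - w v11 + k%:R = m.+1%:R) ->
  iter k down11 (ket C' L' (shift11 w x))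
  = embed11 (ket C L (shift11 w (- k%:R))).
Proof.
move=> hw hk; rewrite iter_down11_ket shift11D [x - _]addrC -shift11D.
rewrite embed11_ket //.
by apply: nonneg; have := in_basis_deep 0 hw hk; rewrite addn0.
Qed.

Lemma embed11_local v : exists k m, iter k down11 v = embed11 m.
Proof.
elim/VC_ind: v => [|u1 u2 [k [m e]] [l [m' e']]|c w hw].
- by exists 0, 0; rewrite linear0.
- exists (k + l)%N, (iter l (rho f) m + iter k (rho f) m').
  rewrite iter_FD linearD -!(iter_F_iota down11_embed) -e -e' -!iterD.
  by rewrite [in X in X + _]addnC.
have -> : w = shift11 (shift11 w (- x)) x by rewrite shift11D addNr shift11_0.
set u := shift11 w (- x).
have hu : in_basis C' L u.
  by apply/(in_basis_shift11E n0 C _ _ x); rewrite shift11D addNr shift11_0.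
have [k hk] := depth11 n0 hC hout hL hu.
exists k, (c *: ket C L (shift11 u (- k%:R))).
by rewrite iter_FZ iter_down11_deep // linearZ.
Qed.

Let adf3 A : bracket f (bracket f (bracket f A)) = 0.
Proof. exact/ad3_sq0/lower_sq0. Qed.

(** The action on V_C'(L + x) with twisting parameter y. Only for y = x does the
    parameter match the entries (1, 1) of the tableaux, so that the
    Gelfand-Tsetlin formulas hold. *)
Definition twisted (y : K) : sl K n -> W -> W :=
  twist char0 rhoP adf3 embed11_inj down11K up11K down11_embed embed11_local y.

(** Deep tableaux and their neighbours satisfy the relations with target (1, 1),
    so that both modules have the same vanishing terms in the formulas. *)
Lemma nonneg11_deep w a e k j :
  (forall b, (b, v11) \in C -> exists m : nat, w b - w v11 + k%:R = m.+1%:R) ->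
  [\/ e = 0, e = 1 | e = - 1] ->
  nonneg11 C (shift11 (shift w a e) (- (k + j)%:R)).
Proof.
move=> hk he b hb; have [m em] := hk b hb.
have /eqP/negPf bv := in11_neq n0 hC hb.
have -> : shift11 (shift w a e) (- (k + j)%:R) b
          - shift11 (shift w a e) (- (k + j)%:R) v11
  = m.+1%:R + j%:R + ((b == a)%:R - (v11 == a)%:R) * e.
  rewrite -em !shift11E bv eqxx !ffunE natrD.
  by case: (b == a); case: (v11 == a) => /=; ring.
have -> : (b == a)%:R - (v11 == a)%:R =
    if b == a then 1 else if v11 == a then -1 else 0 :> K.
  have [<-|_] := eqVneq b a; first by rewrite eq_sym bv subr0.
  by case: (v11 == a); rewrite /= sub0r ?oppr0.
have h0 : exists m0 : nat, m.+1%:R + j%:R = m0%:R :> K.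
  by exists (m.+1 + j)%N; rewrite natrD.
have h1 : exists m0 : nat, m.+1%:R + j%:R + 1 = m0%:R :> K.
  by exists (m.+1 + j).+1; rewrite -natrD natr1.
have h2 : exists m0 : nat, m.+1%:R + j%:R - 1 = m0%:R :> K.
  by exists (m + j)%N; rewrite -natrD addSn -natr1 addrK.
case: he => ->; case: ifP => _; rewrite ?mulr0 ?mulr1 ?mulrN1 ?addr0 ?opprK //.
all: by case: ifP => _; rewrite ?mulN1r ?mul0r ?mul1r ?oppr0 ?addr0 ?opprK.
Qed.

(** A formula with coefficients quadratic in the entry (1, 1) that holds on
    V_C(L) holds for the twisted action on V_C'(L + x). *)
Lemma twisted_ket A w (I : finType) (P : pred I) (a : I -> vertex n)
    (e : I -> K) (g : I -> K -> K) :
  in_basis C' L w -> (forall i, P i -> quadratic (g i)) ->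
  (forall i, P i -> [\/ e i = 0, e i = 1 | e i = - 1]) ->
  (forall t, in_basis C L (shift11 w t) -> rho A (ket C L (shift11 w t)) =
    \sum_(i | P i) g i t *: ket C L (shift (shift11 w t) (a i) (e i))) ->
  twisted x A (ket C' L' (shift11 w x)) =
    \sum_(i | P i) g i x *: ket C' L' (shift (shift11 w x) (a i) (e i)).
Proof.
move=> hw gq he rhoA.
have [k hk] := depth11 n0 hC hout hL hw.
apply: (iter_F_inj down11K (k := k)).
have iter_f j : iter j (rho f) (ket C L (shift11 w (- k%:R)))
    = ket C L (shift11 w (- (k + j)%:R)).
  elim: j => [|j IH] /=; first by rewrite addn0.
  rewrite IH lower11; last exact: in_basis_deep.
  by rewrite shift11D -opprD natr1 addnS.
rewrite (twist_newton char0 rhoP adf3 embed11_inj down11K up11K down11_embed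
  embed11_local x (I := I) (P := P)
  (e := fun i => ket C' L' (shift11 (shift w (a i) (e i)) (x - k%:R)))
  (g := fun i t => g i (t - k%:R)) (iter_down11_deep hw hk)).
- rewrite iter_F_sum; apply: eq_bigr => i Pi.
  by rewrite iter_FZ addrK iter_down11_ket shift_shift11 shift11D.
- by move=> i Pi; exact/quadratic_translate/gq.
- move=> j _; rewrite iter_f rhoA; last exact: in_basis_deep.
  rewrite linear_sum; apply: eq_bigr => i Pi; rewrite linearZ /=.
  rewrite -opprD -natrD [(j + k)%N]addnC iter_down11_ket shift_shift11.
  rewrite embed11_ket.
    rewrite !shift11D; congr (_ *: ket _ _ (shift11 _ _)).
    by rewrite natrD; ring.
  by apply: nonneg11_deep => //; exact: he.
Qed.

Lemma twisted_gt : gt_action (twisted x).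
Proof.
move=> k w' hw'.
have -> : w' = shift11 (shift11 w' (- x)) x by rewrite shift11D addNr shift11_0.
set w := shift11 w' (- x).
have hw : in_basis C' L w.
  by apply/(in_basis_shift11E n0 C _ _ x); rewrite shift11D addNr shift11_0.
split.
- rewrite (@twisted_ket _ w _ (fun a => row_of a == k.+1) id (fun=> 1)
    (fun a t => - raise_coef k.+1 (shift11 w t) a)) //.
  + by rewrite -sumrN; apply: eq_bigr => a _; rewrite scaleNr.
  + move=> a /eqP ra; have [c0 [c1 [c2 e]]] := raise_coef_quadratic w n0 ra.
    by exists (- c0), (- c1), (- c2) => t; rewrite e; ring.
  + by move=> a _; constructor 2.
  + move=> t /(rho_gt k)[-> _ _].
    by rewrite -sumrN; apply: eq_bigr => a _; rewrite scaleNr.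
- rewrite (@twisted_ket _ w _ (fun a => row_of a == k.+1) id (fun=> - 1)
    (fun a t => lower_coef k.+1 (shift11 w t) a)) //.
  + by move=> a /eqP ra; exact: lower_coef_quadratic.
  + by move=> a _; constructor 3.
  + by move=> t /(rho_gt k)[_ -> _].
- have shift0 u : shift u v11 0 = u := shift11_0 u.
  rewrite (@twisted_ket _ w unit predT (fun=> v11) (fun=> 0)
    (fun _ t => cart_coef k.+1 (shift11 w t))) //.
  + by rewrite (big_pred1 tt) ?shift0 // => -[].
  + by move=> _ _; exact: cart_coef_quadratic.
  + by move=> _ _; constructor 1.
  + by move=> t /(rho_gt k)[_ _ ->]; rewrite (big_pred1 tt) ?shift0 // => -[].
Qed.

Lemma twisted_gmodule : is_gmodule (twisted x).
Proof. exact: twist_gmodule. Qed.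

Lemma twisted_localization (M : lmodType K) (rhoM : sl K n -> M -> M) :
  is_gmodule rhoM -> gmodule_iso rho rhoM ->
  is_gmodule (twisted_act rhoM f x) /\
  gmodule_iso (twisted x) (twisted_act rhoM f x).
Proof.
move=> rhoMP [phi [psi phiK psiK] phiE].
have psi_lin : linear psi.
  by move=> c u v; apply: (can_inj phiK); rewrite psiK linearP !psiK.
pose hpsi := GRing.isLinear.Build _ _ _ _ psi psi_lin.
pose psiL : {linear M -> VC C L} := HB.pack psi hpsi.
have psiE A m : psi (rhoM A m) = rho A (psi m).
  by apply: (can_inj phiK); rewrite psiK phiE psiK.
have tf v : twisted 0 f v = down11 v by exact: twist_f.
apply: (@DfM_iso _ _ _ _ _ rhoMP adf3 _ (twisted 0) _
  (embed11 \o psiL) _ _ up11) => //.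
- exact: twist_gmodule.
- by move=> u v /= /embed11_inj; exact: can_inj psiK _ _.
- by move=> A m /=; rewrite psiE; exact/esym/twist_iota.
- by move=> v; rewrite tf down11K.
- by move=> v; rewrite tf up11K.
- move=> v; have [k [m e]] := embed11_local v; exists k, (phi m).
  rewrite /= phiK -e; elim: k {e} => //= k ->; exact: tf.
- by move=> A v; exact: twist_binom.
- exact: twist_gmodule.
Qed.

End LocalizeGT.

(** * Realizations and admissibility without (1, 1) *)

Section Combinatorics.
Variables (K : fieldType) (n : nat).
Hypothesis char0 : [pchar K] =i pred0.
Hypothesis hn : (2 <= n)%N.
Variable C : {set vertex n * vertex n}.
Hypothesis hC : C \subset relations n.
Hypothesis hout : forall b, (v11 n, b) \notin C.
Notation v11 := (v11 n).
Notation C' := (drop11 C).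
Notation n0 := (ltnW hn).
Implicit Types (L w : tableau n K) (a b : vertex n).

Lemma linked_sym (E : {set vertex n * vertex n}) a b :
  linked E a b = linked E b a.
Proof. by apply: sym_connect_sym => x y; rewrite orbC. Qed.

Lemma linked_edge (E : {set vertex n * vertex n}) a b :
  (a, b) \in E -> linked E a b.
Proof. by move=> h; apply: connect1; rewrite h. Qed.

Lemma realization_translate (E : {set vertex n * vertex n}) L w :
  (forall a, exists p : int, w a = L a + p%:~R) ->
  satisfies E w -> realization E L -> realization E w.
Proof.
move=> wL sw [_ hL]; split=> // a b rab ran; rewrite -(hL a b rab ran).
have [p pE] := wL a; have [q qE] := wL b; rewrite pE qE; split=> -[z e].
  by exists (z - p + q); rewrite !(rmorphD, rmorphB) /= -e; ring.
by exists (z + p - q); rewrite !(rmorphD, rmorphB) /= -e; ring.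
Qed.

Lemma in_basis_refl (E : {set vertex n * vertex n}) L :
  satisfies E L -> in_basis E L L.
Proof.
by move=> h; exists [ffun=> 0]; split=> // a; rewrite ffunE // addr0.
Qed.

(** If every realization is regular, the entries of row 2 tied to (1, 1) are
    tied together without it: otherwise one component could be translated to
    make two entries of row 2 equal. *)
Lemma in11_linked L b1 b2 :
  (forall L, realization C L -> regular C L) -> realization C L ->
  (b1, v11) \in C -> (b2, v11) \in C -> linked C' b1 b2.
Proof.
move=> hreg hL h1 h2; apply/negPn/negP => nl.
have /(satisfies_drop11 n0 hC hout)[sL' L11] := hL.1.
have [m1 e1] := L11 _ h1; have [m2 e2] := L11 _ h2.
(* In w the component of b1 is translated by d, which makes w b1 equal to
   w b2, and the entry (1, 1) is lowered enough for C to hold. *)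
pose d : int := m2%:Z - m1%:Z.
have dE : d%:~R = L b2 - L b1 :> K.
  by rewrite rmorphB /= -!pmulrn -e1 -e2; ring.
pose w : tableau n K := [ffun a => L a +
  (if a == v11 then - m1%:Z else if linked C' b1 a then d else 0)%:~R].
have wE a : a <> v11 -> w a = L a + (if linked C' b1 a then d else 0)%:~R.
  by rewrite ffunE => /eqP/negPf ->.
have wv : w v11 = L v11 - m1%:R by rewrite ffunE eqxx rmorphN /= -pmulrn.
have sw : satisfies C w.
  apply/(satisfies_drop11 n0 hC hout); split=> [a b hab|b hb].
    have [hab' av bv] := drop11P _ _ _ hab.
    have -> : w a - w b = L a - L b.
      rewrite !wE //.
      have -> : linked C' b1 b = linked C' b1 a.
        rewrite linked_sym [RHS]linked_sym; apply/esym/same_connect.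
          exact: linked_sym.
        exact: linked_edge.
      by rewrite opprD addrACA subrr addr0.
    exact: sL'.
  have bv := in11_neq n0 hC hb; have [m e] := L11 _ hb.
  rewrite wE // wv; case: ifP => _.
    exists (m + m2)%N; rewrite natrD -e rmorphB /= -!pmulrn; ring.
  exists (m + m1)%N; rewrite natrD -e mulr0z; ring.
have hw : realization C w.
  apply: realization_translate hL => // a; rewrite ffunE.
  by eexists.
have b12 : b1 != b2.
  by apply/eqP => e; case/negP: nl; rewrite e; exact: connect0.
have [r1 _] := in11_row n0 hC h1; have [r2 _] := in11_row n0 hC h2.
apply: (hreg _ hw w (in_basis_refl sw) b1 b2) => //; rewrite ?r1 ?r2 //.
have v1 := in11_neq n0 hC h1; have v2 := in11_neq n0 hC h2; rewrite !wE //.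
by rewrite (negPf nl) /linked connect0 mulr0z dE; ring.
Qed.

Hypothesis in11_tied : forall b1 b2,
  (b1, v11) \in C -> (b2, v11) \in C -> linked C' b1 b2.

Lemma linked_drop11 a b : a <> v11 -> b <> v11 -> linked C a b = linked C' a b.
Proof.
move=> av bv; apply/idP/idP; last first.
  apply: connect_sub => x y /orP[] /drop11P[h _ _]; apply: connect1.
    by rewrite h.
  by rewrite h orbT.
(* A retraction onto the other vertices, sending (1, 1) to a neighbour. *)
pose r c := if c == v11 then odflt v11 [pick b0 | (b0, v11) \in C] else c.
have rN c : c <> v11 -> r c = c by rewrite /r => /eqP/negPf ->.
have rv c : (c, v11) \in C -> linked C' (r v11) c.
  rewrite /r eqxx => h; case: pickP => [b0 hb0|/(_ c)] /=; last by rewrite h.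
  exact: in11_tied.
have step x y : (x, y) \in C -> linked C' (r x) (r y).
  move=> h; have xv : x <> v11 by move=> e; move: h; rewrite e (negPf (hout y)).
  rewrite (rN x) //; have [e|/eqP yv] := eqVneq y v11.
    by rewrite e in h *; rewrite linked_sym; exact: rv.
  by rewrite (rN y) //; apply: linked_edge; apply/drop11P.
rewrite -{2}(rN a av) -{2}(rN b bv).
case/connectP => p; elim: p a {av} => [|c p IH] a /=.
  by move=> _ ->; exact: connect0.
move=> /andP[e pth] lst; apply: connect_trans (IH _ pth lst).
by case/orP: e => /step //; rewrite linked_sym.
Qed.

Lemma row_neq11 a b : row_of a = row_of b -> a <> b -> a <> v11 /\ b <> v11.
Proof.
move=> rab ab; split=> e; apply: ab.
  by rewrite e; apply/esym/eqP; rewrite -row1 -rab e row_v11.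
by rewrite e; apply/eqP; rewrite -row1 rab e row_v11.
Qed.

Lemma realization_drop11 L x :
  (forall a b, row_of a = row_of b -> (row_of a <= n)%N ->
    (exists z : int, L a - L b = z%:~R) <-> linked C a b) <->
  (forall a b, row_of a = row_of b -> (row_of a <= n)%N ->
    (exists z : int, shift11 L x a - shift11 L x b = z%:~R) <-> linked C' a b).
Proof.
by split=> h a b rab ran; have := h a b rab ran;
  (have [<-|/eqP ab] := eqVneq a b;
    [by rewrite !subrr /linked !connect0; split=> // _; exists 0
    |have [av bv] := row_neq11 rab ab; rewrite linked_drop11 //;
     rewrite !shift11_row // row1; exact/eqP]).
Qed.

Lemma realization_drop11_shift L x :
  realization C L -> realization C' (shift11 L x).
Proof.
move=> [/(satisfies_drop11 n0 hC hout)[sL _] hL]; split.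
  exact: satisfies_shift11.
exact/realization_drop11.
Qed.

(** Every realization of the relations not involving (1, 1) comes from a
    realization of C by a change of the entry (1, 1). *)
Lemma realization_lift L' : realization C' L' ->
  exists L x, realization C L /\ L' = shift11 L x.
Proof.
move=> [sL' hL'].
suff [x h11] : exists x, nonneg11 C (shift11 L' x).
  exists (shift11 L' x), (- x); rewrite shift11D addrN shift11_0; split=> //.
  split.
    apply/(satisfies_drop11 n0 hC hout); split=> //.
    exact: satisfies_shift11.
  apply/(realization_drop11 _ (- x)).
  by rewrite shift11D addrN shift11_0.
have [b0 hb0|none] := pickP (fun b => (b, v11) \in C); last first.
  by exists 0 => b; rewrite none.
have [r0 _] := in11_row n0 hC hb0.
have /choice[p pE] : forall b, exists p : int,
    (b, v11) \in C -> L' b - L' b0 = p%:~R.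
  move=> b; have [hb|hb] := boolP ((b, v11) \in C); last by exists 0.
  have [rb _] := in11_row n0 hC hb.
  have rn : (row_of b <= n)%N by rewrite rb.
  have [_ h] := hL' b b0 (etrans rb (esym r0)) rn.
  by have [z e] := h (in11_tied hb hb0); exists z.
pose k := (\max_b `|p b|)%N.
exists (L' b0 - L' v11 - k%:R) => b hb.
have pk : (`|p b| <= k)%N by exact: leq_bigmax.
have [rb _] := in11_row n0 hC hb.
exists (absz (p b + k%:Z)); rewrite shift11_v11 shift11_row ?rb //.
have -> : L' b - (L' v11 + (L' b0 - L' v11 - k%:R)) = (p b)%:~R + k%:R.
  by rewrite -(pE b hb); ring.
rewrite !pmulrn -intrD; congr (_%:~R); lia.
Qed.


(** Admissibility passes to the relations that do not involve (1, 1): the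
    module for these is a twisted localization of a module for C. *)
Lemma admissible_drop11 : admissible K C -> admissible K C'.
Proof.
move=> [_ hadm]; split.
  by apply/(fintype.subset_trans _ hC)/fintype.subsetP => -[a b] /drop11P[].
move=> L' hL'; split=> [w hw a b ab rab ran|].
  have rw : realization C' w.
    have [z [_ zE sw]] := hw; apply: realization_translate hL' => // c.
    by exists (z c).
  have [L [x [hL e]]] := realization_lift rw.
  have [hreg _] := hadm _ hL.
  have [av bv] := row_neq11 rab (elimN eqP ab).
  rewrite e !shift11_row ?row1; [|exact/eqP|exact/eqP].
  exact: hreg (in_basis_refl hL.1) _ _ ab rab ran.
have [L [x [hL ->]]] := realization_lift hL'.
have [_ [rho [rhoP rho_gt]]] := hadm _ hL.
exists (twisted char0 n0 hC hout hL.1 rhoP rho_gt (x := x) x).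
by split; [exact: twisted_gmodule|exact: twisted_gt].
Qed.

End Combinatorics.

(** If f = E_21 is injective, then no relation bounds the entry (1, 1) from
    below, since f lowers this entry until the relation fails. *)
Lemma lower_inj_no_out11 (K : fieldType) (n : nat) (n0 : (0 < n)%N)
    (C : {set vertex n * vertex n}) (L : tableau n K)
    (rho : sl K n -> VC C L -> VC C L) b :
  [pchar K] =i pred0 -> C \subset relations n -> satisfies C L ->
  is_gmodule rho -> gt_action rho -> injective (rho (lower K (Ordinal n0))) ->
  (v11 n, b) \notin C.
Proof.
move=> char0 hC sL rhoP rho_gt rho_inj; apply/negP => hb.
have rb : Rminus (v11 n) b.
  have := fintype.subsetP hC _ hb; rewrite inE /= /Rplus /Rminus /Rzero row_v11.
  rewrite !eqSS [0%N == n]eq_sym eqn0Ngt n0 /= orbF => /orP[|//].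
  by rewrite eq_sym eqn0Ngt row_gt0.
have bv : row_of b != 1%N by rewrite (eqP rb) row_v11.
have basisE w : in_basis C L w -> exists m : nat, w (v11 n) - w b = m.+1%:R.
  by move=> [z [_ _ sw]]; have [_] := sw _ _ hb; apply.
have bad m w : in_basis C L w -> w (v11 n) - w b = m.+1%:R -> False.
  elim: m w => [|m IH] w hw e.
    have /basisE[m'] : in_basis C L (shift11 w (- 1)).
      apply: contrapT => hw'; apply: (ket_neq0 hw); apply: rho_inj.
      by rewrite gmod0 // lower11 // ket_out.
    rewrite shift11_v11 shift11_row // addrAC e subrr => /esym/eqP.
    by have /pcharf0P -> := char0.
  have hw' : in_basis C L (shift11 w (- 1)).
    apply: contrapT => hw'; apply: (ket_neq0 hw); apply: rho_inj.
    by rewrite gmod0 // lower11 // ket_out.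
  apply: (IH _ hw'); rewrite shift11_v11 shift11_row // addrAC e.
  by rewrite -[in LHS]natr1 addrK.
have hL := in_basis_refl sL; have [m e] := basisE _ hL.
exact: bad hL e.
Qed.

Theorem theorem1p1 (R : realType) (n : nat) (hn : (2 <= n)%N)
    (M : lmodType (complex R)) (rho : sl (complex R) n -> M -> M) :
  let f := lower (complex R) (Ordinal (ltnW hn)) in
  relation_module rho -> injective (rho f) ->
  forall x : complex R, relation_module (twisted_act rho f x).
Proof.
move=> f [rhoP [C [L [rho0 [adm hL rho0P rho0_gt iso]]]]] f_inj x.
have char0 : [pchar (complex R)] =i pred0 := @Num.Theory.pchar_num _.
have [hC hadm] := adm.
have f0_inj : injective (rho0 f).
  have [phi /bij_inj phi_inj phiE] := iso.
  by move=> u v e; apply/phi_inj/f_inj; rewrite -!phiE e.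
have hout b : (v11 n, b) \notin C.
  exact: lower_inj_no_out11 char0 hC hL.1 rho0P rho0_gt f0_inj.
have tied b1 b2 : (b1, v11 n) \in C -> (b2, v11 n) \in C ->
    linked (drop11 C) b1 b2.
  by apply: (in11_linked hn hC hout _ hL) => L1 /hadm[].
have [twP twIso] := twisted_localization char0 (ltnW hn) hC hout hL.1 rho0P
  rho0_gt x rhoP iso.
split=> //.
exists (drop11 C), (shift11 L x),
  (twisted char0 (ltnW hn) hC hout hL.1 rho0P rho0_gt (x := x) x).
split=> //.
- exact: admissible_drop11.
- exact: realization_drop11_shift.
- exact: twisted_gmodule.
- exact: twisted_gt.
Qed.
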